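(* Let $\mathcal{T}=(V,E,T,P_1,P_2,P_3,P_4)$ be a triangulation of a topological planar quadrilateral $Q$, let $F\subset V$ be the set of vertices not on $\partial Q$, let $c$ be a conductance function and let $\bar\Gamma(F)=(\bar F,\bar E,\bar c)$ be the associated network. Let $g>0$ be a constant, let $f$ be the Dirichlet-Neumann boundary value function on $\bar\Gamma(F)$ with constant $g$, let $I(f)$ be its Dirichlet energy, and let $\rho$ be the gradient metric induced by $f$. Let $$M=\max\Big(\{\|\overrightarrow{c}_{F}(x)\| : x\in F\}\cup\{\|\overrightarrow{c}_{\delta(F)}(x)\| : x\in\delta(F)\}\Big),\qquad m=\min_{(x,y)\in\bar E}\sqrt{c(x,y)}.$$ 1. If $\gamma^*$ is a shortest vertically thick path connecting $P_1$ to $P_3$ (that is, of minimal $\rho$-length among all vertically thick paths), then $$\mathrm{length}_\rho(\gamma^* )\ \ge\ \frac{I(f)}{g\,M}.$$ 2. If $\gamma$ is a shortest horizontally thick path connecting $P_2$ to $P_4$ (that is, of minimal $\rho$-length among all horizontally thick paths), then $$\mathrm{length}_\rho(\gamma)\ \ge\ g\,m.$$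
   Context: **Triangulated quadrilateral.** A quadrilateral $Q$ is a topological planar closed disk with four distinguished points on its boundary, called corners. A triangulation $\mathcal{T}=(V,E,T,P_1,P_2,P_3,P_4)$ of $Q$ consists of a triangulation of $Q$ with vertices $V$, edges $E$ and triangles $T$ (finite, with simple connected planar $1$-skeleton), together with a decomposition $\partial Q=P_1\cup P_2\cup P_3\cup P_4$ into four non-trivial arcs of the triangulation with disjoint interiors, in cyclic order; if the intersection of any two of the arcs is nonempty, it consists of a corner. All corners are vertices, and, for the purpose of assigning vertices to the sets $P_i$, each corner belongs to one and only one of the $P_i$'s. Below $P_i$ also denotes the corresponding set of vertices. **Network.** A conductance function assigns to each edge $(x,y)$ a number $c(x,y)=c(y,x)>0$. $F$ is the set of vertices not on $\partial Q$; $\delta(F)=\{x\in V\setminus F : (x,y)\in E \text{ for some } y\in F\}$, and it is assumed that $\delta(F)$ is exactly the set of vertices in $P_1\cup P_2\cup P_3\cup P_4$. Set $\bar F=F\cup\delta(F)$ and $\bar E=\{(x,y)\in E : x\in F\}$ (undirected edges with at least one endpoint in $F$, each counted once); $\bar\Gamma(F)=(\bar F,\bar E,\bar c)$ with $\bar c=c|_{\bar E}$. Write $x\sim y$ if $(x,y)\in\bar E$; thus for $x\in\delta(F)$ the neighbors are taken only from $F$. **Potential, energy, normal derivative.** For $u:\bar F\to[0,\infty)$: $\Delta u(x)=\sum_{y\sim x}c(x,y)(u(x)-u(y))$; $u$ is harmonic in $F$ if $\Delta u(x)=0$ for all $x\in F$; the Dirichlet energy is $I(u)=\sum_{(x,y)\in\bar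 E}c(x,y)(u(x)-u(y))^2$; the normal derivative at $x\in\delta(F)$ is $\frac{\partial u}{\partial n_F}(x)=\sum_{y\sim x,\,y\in F}c(x,y)(u(x)-u(y))$. **Dirichlet-Neumann boundary value function** with constant $g>0$: a function $f:\bar F\to[0,\infty)$ that is harmonic in $F$, with $f|_{P_2}=0$, $f|_{P_4}=g$, and $\frac{\partial f}{\partial n_F}=0$ on $P_1$ and on $P_3$. **Vectors and norms.** For $x\in\bar F$, vectors indexed by the edges $(x,y)$, $y\sim x$, carry the inner product $(a,b)=\sum_{y\sim x}\frac{a(x,y)b(x,y)}{c(x,y)}$ with associated norm $\|\cdot\|$. The conductance vector, denoted $\overrightarrow{c}_F(x)$ for $x\in F$ and $\overrightarrow{c}_{\delta(F)}(x)$ for $x\in\delta(F)$, is $(c(x,y))_{y\sim x}$; so its norm is $\big(\sum_{y\sim x}c(x,y)\big)^{1/2}$. For $x\in F$, $\overrightarrow{df}(x)=(c(x,y)(f(y)-f(x)))_{y\sim x}$, and for $x\in\delta(F)$, $\overrightarrow{\frac{\partial f}{\partial n_F}}(x)=(c(x,y)(f(x)-f(y)))_{y\sim x}$. **Gradient metric.** $\rho:\bar F\to[0,\infty)$ is $\rho(x)=\|\overrightarrow{df}(x)\|$ for $x\in F$ and $\rho(x)=\|\overrightarrow{\frac{\partial f}{\partial n_F}}(x)\|$ for $x\in\delta(F)$; equivalently $\rho(x)=\big(\sum_{y\sim x}c(x,y)(f(x)-f(y))^2\big)^{1/2}$ for all $x\in\bar F$. The $\rho$-length of a path $\alpha$ (a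 finite sequence of vertices, consecutive ones adjacent in $\bar\Gamma(F)$) is $\mathrm{length}_\rho(\alpha)=\sum_{x\in\alpha}\rho(x)$. $\mathrm{dist}$ denotes the combinatorial distance (minimal number of edges of a path), also used for distance to a set of vertices. **Thick paths.** A path $\beta=(x_0,x_1,\dots,x_n)$ is vertically thick (respectively horizontally thick) if: (1) $\beta\cap P_3=\{x_0\}$ and $\beta\cap P_1=\{x_n\}$ (respectively $\beta\cap P_2=\{x_0\}$ and $\beta\cap P_4=\{x_n\}$); (2) neither $x_0$ nor $x_n$ is a corner; (3) $x_i\in F$ for all $i=1,\dots,n-1$; (4) $\mathrm{dist}(x_i,P_3\cup P_4\cup P_1)>1$ for all $i=2,\dots,n-2$; (5) for all $x\in P_1\cup P_3\cup P_4$ (respectively for all $x\in\delta(F)$), $\mathrm{dist}(x_1,x)\ge1$ and $\mathrm{dist}(x_{n-1},x)\ge 1$, where $\mathrm{dist}(x_1,x)=1$ only for $x=x_0$ and $\mathrm{dist}(x_{n-1},x)=1$ only for $x=x_n$. *)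

(* Defs.v *)
From HB Require Import structures.
From mathcomp Require Import all_boot all_order all_algebra.
From mathcomp Require Import all_classical all_reals all_analysis.
Import Order.TTheory GRing.Theory Num.Theory.
Import numFieldNormedType.Exports.

Set Implicit Arguments.
Unset Strict Implicit.
Unset Printing Implicit Defensive.

Local Open Scope classical_set_scope.
Local Open Scope ring_scope.

Definition homeomorphism_on (X Y : topologicalType) (A : set X) (B : set Y)
    (h : X -> Y) : Prop :=
  [/\ set_bij A B h, {within A, continuous h} &
      exists k : Y -> X, {within B, continuous k} /\
        (forall x, A x -> k (h x) = x)].

Definition unit_disk (R : realType) : set (R * R) :=
  [set p | p.1 ^+ 2 + p.2 ^+ 2 <= 1].

Definition unit_circle (R : realType) : set (R * R) :=
  [set p | p.1 ^+ 2 + p.2 ^+ 2 = 1].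

(* The boundary of a topological disk is the image of the unit circle; it does
   not depend on the chosen chart, and for a disk in the plane it is also its
   topological frontier (both by invariance of domain). *)
Record quadrilateral (R : realType) := Quadrilateral {
  disk : set (R * R);
  chart : R * R -> R * R;
  chartP : homeomorphism_on (@unit_disk R) disk chart;
  corner_pt : 'I_4 -> R * R;
  corner_pt_inj : injective corner_pt;
  corner_ptP : forall i, (chart @` @unit_circle R) (corner_pt i) }.

Definition boundary_pts (R : realType) (Q : quadrilateral R) : set (R * R) :=
  chart Q @` @unit_circle R.

(* Points are described by their barycentric coordinates with respect to the
   vertices. *)
Section Realization.
Context {R : realType} {V : finType}.

Definition bsupp (p : V -> R) : {set V} := [set v | p v != 0]%SET.

Definition vertex_pt (v : V) : {ptws V -> R} := fun w => (w == v)%:R.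

Definition simplices (edge : rel V) (tri : {set {set V}}) : {set {set V}} :=
  [set s : {set V} | [exists v, s == [set v]]
                  || [exists v, exists w, edge v w && (s == [set v; w])]
                  || (s \in tri)]%SET.

Definition realization (K : {set {set V}}) : set {ptws V -> R} :=
  [set p | [/\ forall v, 0 <= p v, \sum_v p v = 1 & bsupp p \in K]].

Definition segment (x y : V) : set {ptws V -> R} :=
  [set p | [/\ forall v, 0 <= p v, \sum_v p v = 1
             & bsupp p \subset [set x; y]%SET]].

End Realization.

(* A triangulation of Q is a finite simplicial complex of dimension at most 2
   (vertices V, edges edge, triangles tri) with a homeomorphism emb from its
   geometric realization onto Q. The i-th boundary arc is the edge path that
   starts at corner i, runs through inner i and ends at the next corner in
   cyclic order; the index i : 'I_4 stands for the arc numbered i + 1.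
   part i is the set of vertices assigned to the i-th arc, so that a corner,
   which lies on two arcs, is assigned to exactly one of them. *)
Record triangulation (R : realType) (V : finType) (Q : quadrilateral R) :=
  Triangulation {
  edge : rel V;
  edge_sym : symmetric edge;
  edge_irr : irreflexive edge;
  edge_connected : forall x y, connect edge x y;
  tri : {set {set V}};
  tri_card : forall t, t \in tri -> #|t| = 3%N;
  tri_edge : forall t x y, t \in tri -> x \in t -> y \in t -> x != y ->
    edge x y;
  emb : {ptws V -> R} -> R * R;
  embP : homeomorphism_on (realization (simplices edge tri)) (disk Q) emb;
  corner : 'I_4 -> V;
  cornerP : forall i, emb (vertex_pt (corner i)) = corner_pt Q i;
  inner : 'I_4 -> seq V;
  side_path : forall i,
    path edge (corner i) (rcons (inner i) (corner (ordS i)));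
  sides_uniq : uniq (flatten [seq corner i :: inner i | i <- enum 'I_4]);
  sides_boundary : boundary_pts Q =
    [set q | exists i, exists2 e : V * V,
       e \in zip (corner i :: inner i) (rcons (inner i) (corner (ordS i)))
       & (emb @` segment e.1 e.2) q];
  part : 'I_4 -> {set V};
  part_side : forall i x, x \in part i ->
    x \in corner i :: rcons (inner i) (corner (ordS i));
  part_disjoint : forall i j x, x \in part i -> x \in part j -> i = j;
  part_cover : forall i x,
    x \in corner i :: rcons (inner i) (corner (ordS i)) ->
    exists j, x \in part j }.

Section Network.
Context {R : realType} {V : finType} {Q : quadrilateral R}.
Variable T : triangulation V Q.

Definition P1 : {set V} := part T 0.
Definition P2 : {set V} := part T 1.
Definition P3 : {set V} := part T 2.
Definition P4 : {set V} := part T 3.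

Definition is_corner (x : V) : bool := [exists i, x == corner T i].

Definition F : {set V} :=
  [set x | ~~ `[< boundary_pts Q (emb T (vertex_pt x)) >]]%SET.

Definition deltaF : {set V} :=
  [set x | (x \notin F) && [exists y in F, edge T x y]]%SET.

Definition Fbar : {set V} := (F :|: deltaF)%SET.

Definition adj : rel V :=
  fun x y => edge T x y && ((x \in F) || (y \in F)).

Definition conductance (c : V -> V -> R) : Prop :=
  forall x y, edge T x y -> 0 < c x y /\ c x y = c y x.

Variable c : V -> V -> R.

Definition laplacian (u : V -> R) (x : V) : R :=
  \sum_(y | adj x y) c x y * (u x - u y).

Definition harmonic_in_F (u : V -> R) : Prop :=
  forall x, x \in F -> laplacian u x = 0.

(* The double sum visits every undirected edge twice, hence the factor 1/2. *)
Definition energy (u : V -> R) : R :=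
  (\sum_x \sum_(y | adj x y) c x y * (u x - u y) ^+ 2) / 2.

Definition normal_derivative (u : V -> R) (x : V) : R :=
  \sum_(y | adj x y && (y \in F)) c x y * (u x - u y).

(* Functions on the vertices of the network are represented by functions on V
   of which only the values on Fbar are constrained and used. *)
Definition DN_boundary_value_function (g : R) (f : V -> R) : Prop :=
  (forall x, x \in Fbar -> 0 <= f x) /\
  harmonic_in_F f /\
  (forall x, x \in P2 -> f x = 0) /\
  (forall x, x \in P4 -> f x = g) /\
  (forall x, x \in (P1 :|: P3)%SET -> normal_derivative f x = 0).

(* A vector indexed by the edges (x, y), y ~ x, is a function of y, used only
   at the neighbours of x. *)
Definition edge_dot (x : V) (a b : V -> R) : R :=
  \sum_(y | adj x y) a y * b y / c x y.

Definition edge_norm (x : V) (a : V -> R) : R := Num.sqrt (edge_dot x a a).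

Definition conductance_vector (x : V) : V -> R := fun y => c x y.

Definition df_vector (f : V -> R) (x : V) : V -> R :=
  fun y => c x y * (f y - f x).

Definition dn_vector (f : V -> R) (x : V) : V -> R :=
  fun y => c x y * (f x - f y).

Definition gradient_metric (f : V -> R) (x : V) : R :=
  if x \in F then edge_norm x (df_vector f x)
  else edge_norm x (dn_vector f x).

Definition conductance_norms : set R :=
  [set r | exists2 x, x \in F & r = edge_norm x (conductance_vector x)]
  `|` [set r | exists2 x, x \in deltaF & r = edge_norm x (conductance_vector x)].

Definition sqrt_conductances : set R :=
  [set r | exists x y, adj x y /\ r = Num.sqrt (c x y)].

End Network.

Definition is_maximum (R : realType) (A : set R) (M : R) : Prop :=
  A M /\ ubound A M.

Definition is_minimum (R : realType) (A : set R) (m : R) : Prop :=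
  A m /\ lbound A m.

Section Paths.
Context {R : realType} {V : finType} {Q : quadrilateral R}.
Variable T : triangulation V Q.

(* +oo when y cannot be reached from x *)
Definition dist (x y : V) : \bar R :=
  ereal_inf [set ((size s)%:R)%:E | s in
    [set s : seq V | path (adj T) x s /\ last x s = y]].

Definition dist_set (x : V) (A : {set V}) : \bar R :=
  ereal_inf [set dist x y | y in [set y | y \in A]].

(* The path (x_0, ..., x_n) is the sequence x0 :: s, so that n = size s. *)
Definition thick_path (A B S : {set V}) (b : seq V) : Prop :=
  if b is x0 :: s then
    let n := size s in
    let x i := nth x0 b i in
    path (adj T) x0 s /\
    ([set y in b] :&: A = [set x0] /\ [set y in b] :&: B = [set x n])%SET /\
    (~~ is_corner T x0 /\ ~~ is_corner T (x n)) /\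
    (forall i, (1 <= i <= n.-1)%N -> x i \in F T) /\
    (forall i, (2 <= i <= n - 2)%N ->
       (1 < dist_set (x i) (P3 T :|: P4 T :|: P1 T)%SET)%E) /\
    (forall z, z \in S ->
       [/\ (1 <= dist (x 1%N) z)%E, (1 <= dist (x n.-1) z)%E,
           dist (x 1%N) z = 1%E -> z = x0
         & dist (x n.-1) z = 1%E -> z = x n])
  else False.

Definition vertically_thick : seq V -> Prop :=
  thick_path (P3 T) (P1 T) (P1 T :|: P3 T :|: P4 T)%SET.

Definition horizontally_thick : seq V -> Prop :=
  thick_path (P2 T) (P4 T) (deltaF T).

Definition path_length (rho : V -> R) (b : seq V) : R := \sum_(x <- b) rho x.

Definition shortest (rho : V -> R) (thick : seq V -> Prop) (b : seq V) : Prop :=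
  thick b /\ forall b', thick b' -> path_length rho b <= path_length rho b'.

End Paths.

(* Main.v *)
Require Import Defs.
From mathcomp Require Import all_boot all_order all_algebra.
From mathcomp Require Import all_classical all_reals all_analysis.
From mathcomp Require Import ring lra zify.
Import Order.TTheory GRing.Theory Num.Theory.
Import numFieldNormedType.Exports.

(* By Green's formula I(f) equals g times the flux of f through P4. A vertically
   thick path gamma separates P4 from P2, so this flux also passes through
   gamma, and by Cauchy-Schwarz at most |c(y)| rho(y) of it passes through a
   vertex y. For a horizontally thick path, the drop g of f along the path is
   the sum of its drops along the edges, each at most rho / m.

   The separation is a planarity statement: edge paths joining opposite sides of
   Q share a vertex. Such paths are curves in the unit disk whose end points
   interlace on the circle. A projective map turns the disk into a subset of the
   unit square touching its sides in the four end points, and the difference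
   gamma(s) - beta(t) of the two curves then vanishes somewhere by the
   Poincare-Miranda theorem, which is proved by a parity count on grids. *)

Set Implicit Arguments.
Unset Strict Implicit.
Unset Printing Implicit Defensive.

Local Open Scope classical_set_scope.
Local Open Scope ring_scope.

(** * The Poincare-Miranda theorem in the plane *)

(** The crossing of curves needs metric data, end points on opposite sides of a chord, while a
    triangulation provides only a cyclic order of boundary vertices. The bridge is that the boundary
    edges cover the whole circle and that each of the two arcs between two chosen vertices meets the
    line through them only at its ends; the intermediate value theorem then puts each open arc on
    one side. In the other direction, a common point of the curves yields a common vertex because
    both curves live in the geometric realization, on which [emb] is injective: the point has a
    nonzero barycentric coordinate, and a curve has nonzero coordinates only at vertices of its edge
    path. No analysis of how edges may intersect is required. The forms [1 - <z, x>] are used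
    because, for [z] on the circle, they vanish at a single point of the disk; this gives the strict
    signs on the sides of the square that the parity count demands. *)

Definition constant_on_cell (L : nat -> nat -> bool) (i j : nat) : Prop :=
  [/\ L i.+1 j = L i j, L i j.+1 = L i j & L i.+1 j.+1 = L i j].

(* An edge of the grid is marked when [S] changes along it and [A] holds at its
   origin. If [A] or [S] is constant on a cell, the cell has an even number of
   marked sides; hence so has the whole grid, although its right side has an odd
   number of them and the other sides have none. *)
Lemma grid_crossing (n : nat) (A S : nat -> nat -> bool) :
  (forall j, (j <= n)%N -> A 0%N j = false /\ A n j = true) ->
  (forall i, (i <= n)%N -> S i 0%N = false /\ S i n = true) ->
  ~ (forall i j, (i < n)%N -> (j < n)%N ->
       constant_on_cell A i j \/ constant_on_cell S i j).
Proof.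
move=> bA bS cell.
pose w i j := (S i j (+) S i j.+1) && A i j.
pose h i j := (S i j (+) S i.+1 j) && A i j.
pose col i m := \big[addb/false]_(j < m) w i j.
have colS i m : col i m.+1 = col i m (+) w i m by rewrite /col big_ord_recr.
have col0 i : col i 0%N = false by rewrite /col big_ord0.
(* The [m] lowest cells of the strip between columns [i] and [i.+1]: the sides they share cancel,
   leaving the outline of the stack. *)
have step i m : (i < n)%N -> (m <= n)%N ->
    col i m (+) col i.+1 m = h i 0%N (+) h i m.
  move=> lin; elim: m => [|m IH] lmn; first by rewrite !col0 !addbb.
  have := IH (ltnW lmn); have := cell i m lin lmn.
  rewrite !colS /w /h /constant_on_cell.
  case=> -[e1 e2 e3]; rewrite ?e1 ?e2 ?e3;
    move: (col i m) (col i.+1 m) (S i 0%N) (S i.+1 0%N) (A i 0%N)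
      (S i m) (S i.+1 m) (S i m.+1) (S i.+1 m.+1) (A i m) (A i.+1 m);
    by do 11 case.
have colE i : (i <= n)%N -> col i n = col 0%N n.
  elim: i => // i IH lin.
  have := step i n lin (leqnn n); rewrite IH ?(ltnW lin)// /h.
  have [-> ->] := bS i (ltnW lin); have [-> ->] := bS i.+1 lin.
  by move: (col 0%N n) (col i.+1 n); do 2 case.
have c0 : col 0%N n = false.
  rewrite /col big1 // => j _; rewrite /w.
  by have [-> _] := bA j (ltnW (ltn_ord j)); rewrite andbF.
(* On the right side [A] is true, so the changes of [S] telescope. *)
have cn m : (m <= n)%N -> col n m = S n 0%N (+) S n m.
  elim: m => [|m IH] lmn; first by rewrite col0 addbb.
  rewrite colS IH ?(ltnW lmn)// /w; have [_ ->] := bA m (ltnW lmn).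
  by rewrite andbT addbA -(addbA (S n 0%N)) addbb addbF.
have := cn n (leqnn n); rewrite colE // c0.
by have [-> ->] := bS n (leqnn n).
Qed.

Section PoincareMiranda.
Context {R : realType}.

Let square : set (R * R) := `[0, 1]%classic `*` `[0, 1]%classic.

(** The radius is twice the mesh [1 / n.+1], so that the open ball around the lower left corner of a
    cell contains all four corners. *)
Let cst_sign (h : R * R -> R) (n : nat) (x : R * R) : Prop :=
  forall y z, ball x (2 / n.+1%:R) y -> ball x (2 / n.+1%:R) z ->
    (0 < h y) = (0 < h z).

Let near_cst_sign (h : R * R -> R) (x : R * R) :
  continuous h -> h x != 0 ->
  \forall x' \near x & n \near \oo, cst_sign h n x'.
Proof.
move=> ch hx0.
have [e e0 he] : exists2 e : R, 0 < e &
    forall y, ball x e y -> (0 < h y) = (0 < h x).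
  have [hx|hx] := ltP 0 (h x).
    have : \forall y \near x, 0 < h y by exact: ch x _ (lt_nbhsr hx).
    by case/nbhs_ballP => e e0 he; exists e => // y /he /= ->.
  have {}hx : h x < 0 by rewrite lt_neqAle hx0.
  have : \forall y \near x, h y < 0 by exact: ch x _ (lt_nbhsl hx).
  case/nbhs_ballP => e e0 he; exists e => // y /he /=.
  by move=> hy; rewrite (lt_gtF hy).
have e20 : 0 < e / 2 by rewrite divr_gt0.
have [N _ HN] : \forall n \near \oo, 2 / n.+1%:R < e / 2.
  near=> n.
  rewrite ltr_pdivrMr // mulrC -ltr_pdivrMr //.
  apply: (@lt_trans _ _ n%:R); last by rewrite ltr_nat.
  near: n; exact: nbhs_infty_gtr.
exists (ball x (e / 2), [set n | (N <= n)%N]); first split.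
- exact: nbhsx_ballx.
- exact: nbhs_infty_ge.
- move=> [x' n] /= [xx' Nn] y z xy xz.
  have H t : ball x' (2 / n.+1%:R) t -> ball x e t.
    move=> x't; rewrite (splitr e); apply: ball_triangle xx' _.
    by apply: le_ball x't; apply/ltW/HN.
  by rewrite he ?(he z)//; exact: H.
Unshelve. all: by end_near. Qed.

(** Without a common zero, near each point one of the two functions keeps its sign. On a fine enough
    grid every cell then has a constant sign for one of them, which [grid_crossing] forbids. *)
Lemma poincare_miranda (h1 h2 : R * R -> R) :
  continuous h1 -> continuous h2 ->
  (forall t, 0 <= t <= 1 -> h1 (0, t) < 0 /\ 0 < h1 (1, t)) ->
  (forall s, 0 <= s <= 1 -> h2 (s, 0) < 0 /\ 0 < h2 (s, 1)) ->
  exists s t, [/\ 0 <= s <= 1, 0 <= t <= 1, h1 (s, t) = 0 & h2 (s, t) = 0].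
Proof.
move=> c1 c2 b1 b2; apply: contrapT => noz.
have csq : compact square by apply: compact_setX; exact: segment_compact.
(* This plays the role of a Lebesgue number: a single [n] serves all points of the square. *)
move/compact_near_coveringP : csq => /(_ nat \oo
  (fun n x => cst_sign h1 n x \/ cst_sign h2 n x) _).
have loc x : square x ->
    \forall x' \near x & n \near \oo, cst_sign h1 n x' \/ cst_sign h2 n x'.
  case: x => s t -[/= s01 t01].
  rewrite !in_itv /= in s01 t01.
  have [h10|h10] := eqVneq (h1 (s, t)) 0; last first.
    by apply: filterS (near_cst_sign c1 h10) => -[x' n] /= H; left.
  have [h20|h20] := eqVneq (h2 (s, t)) 0; last first.
    by apply: filterS (near_cst_sign c2 h20) => -[x' n] /= H; right.
  by exfalso; apply: noz; exists s, t.
move=> /(_ loc)[n _ /(_ n (leqnn n)) Hn].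
pose pt (i j : nat) : R * R := (i%:R / n.+1%:R, j%:R / n.+1%:R).
have pt01 (i : nat) : (i <= n.+1)%N -> 0 <= i%:R / n.+1%:R <= (1 : R).
  move=> lin; rewrite divr_ge0 //= ler_pdivrMr // mul1r ler_nat //.
have n1 : n.+1%:R / n.+1%:R = 1 :> R by rewrite divff.
apply: (@grid_crossing n.+1 (fun i j => 0 < h1 (pt i j))
                            (fun i j => 0 < h2 (pt i j))).
- move=> j /pt01 /b1[H0 H1]; rewrite /pt n1 mul0r; split => //.
  by rewrite (lt_gtF H0).
- move=> j /pt01 /b2[H0 H1]; rewrite /pt n1 mul0r; split => //.
  by rewrite (lt_gtF H0).
- move=> i j lin ljn.
  have sq : square (pt i j).
    by split; rewrite /= in_itv /=; apply: pt01; exact: ltnW.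
  have bx (a b : nat) : (a <= 1)%N -> (b <= 1)%N ->
      ball (pt i j) (2 / n.+1%:R) (pt (i + a)%N (j + b)%N).
    have key (k d : nat) : (d <= 1)%N ->
        ball (k%:R / n.+1%:R : R) (2 / n.+1%:R) ((k + d)%N%:R / n.+1%:R).
      move=> d1; rewrite /ball /= -mulrBl normrM natrD opprD addrA subrr sub0r.
      rewrite normrN normfV !normr_nat ltr_pM2r ?invr_gt0 // ltr_nat.
      exact: leq_ltn_trans d1 _.
    by move=> a1 b1'; split => /=; apply: key.
  have B00 := bx 0%N 0%N isT isT; have B10 := bx 1%N 0%N isT isT.
  have B01 := bx 0%N 1%N isT isT; have B11 := bx 1%N 1%N isT isT.
  rewrite !addn0 ?addn1 in B00 B10 B01 B11.
  by case: (Hn _ sq) => H; [left|right]; split; exact: H.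
Qed.

End PoincareMiranda.

(** * Crossing curves in the disk *)

Section Disk.
Context {R : realType}.
Implicit Types p q r w x y o : R * R.

Lemma continuous_fst (T : topologicalType) (v : T -> R * R) :
  continuous v -> continuous (fun t => (v t).1).
Proof.
move=> cv t; apply: (@cvg_comp _ _ _ v fst _ _ _ (cv t)).
by case: (v t) => a b; exact: cvg_fst.
Qed.

Lemma continuous_snd (T : topologicalType) (v : T -> R * R) :
  continuous v -> continuous (fun t => (v t).2).
Proof.
move=> cv t; apply: (@cvg_comp _ _ _ v snd _ _ _ (cv t)).
by case: (v t) => a b; exact: cvg_snd.
Qed.

Definition dot x y : R := x.1 * y.1 + x.2 * y.2.

Definition combination (a b : R) p q : R * R :=
  (a * p.1 + b * q.1, a * p.2 + b * q.2).

(** The determinant of [q - p] and [x - p]: zero on the line through [p] and [q], with opposite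
    signs on its two sides. *)
Definition chord_side p q x : R :=
  (q.1 - p.1) * (x.2 - p.2) - (q.2 - p.2) * (x.1 - p.1).

(** The tangent at [p] touches the disk at [p] only, since [|p - x|^2 <= 2 (1 - <p, x>)]. *)
Lemma dot_lt1 p x : unit_circle p -> unit_disk x -> x <> p -> dot p x < 1.
Proof.
case: p x => [p1 p2] [x1 x2]; rewrite /unit_circle /unit_disk /dot /= => hp hx.
move=> xp; rewrite lt_neqAle; apply/andP; split; last first.
  by have := sqr_ge0 (p1 - x1); have := sqr_ge0 (p2 - x2); nra.
apply/eqP => e; apply: xp.
have /eqP : (p1 - x1) ^+ 2 + (p2 - x2) ^+ 2 = 0.
  by apply/eqP; rewrite eq_le addr_ge0 ?sqr_ge0 // andbT; nra.
rewrite paddr_eq0 ?sqr_ge0 // !sqrf_eq0 !subr_eq0 => /andP[/eqP -> /eqP ->].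
by [].
Qed.

Lemma dot_combination (a b : R) p q x : a + b = 1 ->
  1 - dot (combination a b p q) x = a * (1 - dot p x) + b * (1 - dot q x).
Proof.
move=> ab; have -> : b = 1 - a by lra. rewrite /dot /=. ring.
Qed.

Lemma unit_circle_disk p : unit_circle p -> unit_disk p.
Proof. by rewrite /unit_circle /unit_disk /= => ->. Qed.

Lemma chord_side_eq0_combination p q o : p <> q -> chord_side p q o = 0 ->
  exists a b : R, a + b = 1 /\ combination a b p q = o.
Proof.
rewrite /chord_side => pq Lo'.
pose N := (q.1 - p.1) ^+ 2 + (q.2 - p.2) ^+ 2.
have N0 : N != 0.
  apply/eqP => /eqP; rewrite paddr_eq0 ?sqr_ge0 // !sqrf_eq0 !subr_eq0.
  move=> /andP[/eqP e1 /eqP e2]; apply: pq.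
  by rewrite (surjective_pairing p) (surjective_pairing q) e1 e2.
(* The parameter of the orthogonal projection of [o] on the line, which is [o] itself. *)
pose b := ((o.1 - p.1) * (q.1 - p.1) + (o.2 - p.2) * (q.2 - p.2)) / N.
pose a := 1 - b.
have ab : a + b = 1 by rewrite /a; ring.
exists a, b; split=> //.
have k1 : b * (q.1 - p.1) = o.1 - p.1.
  apply: (mulIf N0); rewrite mulrAC divfK //; apply/eqP.
  by rewrite -subr_eq0 -(mulr0 (q.2 - p.2)) -Lo' /N; apply/eqP; ring.
have k2 : b * (q.2 - p.2) = o.2 - p.2.
  apply: (mulIf N0); rewrite mulrAC divfK //; apply/eqP.
  by rewrite -subr_eq0 -(mulr0 (p.1 - q.1)) -Lo' /N; apply/eqP; ring.
have l1 : a * p.1 + b * q.1 = o.1 by rewrite /a; lra.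
have l2 : a * p.2 + b * q.2 = o.2 by rewrite /a; lra.
by rewrite /combination l1 l2 -surjective_pairing.
Qed.

(** The power of the point [o] with respect to the circle, [a b |p - q|^2], where
    [|p - q|^2 = 2 (1 - <p, q>)]. For distinct [p] and [q], it makes [a b > 0] equivalent to [o]
    being inside the circle. *)
Lemma norm_combination (a b : R) p q (o := combination a b p q) :
  a + b = 1 -> unit_circle p -> unit_circle q ->
  1 - (o.1 ^+ 2 + o.2 ^+ 2) = 2 * (a * b * (1 - dot p q)).
Proof.
rewrite /unit_circle /= => ab cp cq.
have <- : a ^+ 2 * (1 - (p.1 ^+ 2 + p.2 ^+ 2)) +
    b ^+ 2 * (1 - (q.1 ^+ 2 + q.2 ^+ 2)) + 2 * (a * b * (1 - dot p q)) =
    2 * (a * b * (1 - dot p q)) by rewrite cp cq; ring.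
by rewrite /o /combination /dot /= (_ : b = 1 - a); [ring | lra].
Qed.

(** The weights [c] and [d] are solved from the vanishing of the affine function [chord_side p q] on
    the line through [r] and [w]; they are positive as its values at [r] and [w] have opposite
    signs. So [o] is inside the circle, and [norm_combination] read backwards makes [a] and [b]
    positive. *)
Lemma chord_meet p q r w :
  unit_circle p -> unit_circle q -> unit_circle r -> unit_circle w ->
  chord_side p q r * chord_side p q w < 0 ->
  exists a b c d : R, [/\ 0 < a, 0 < b, 0 < c & 0 < d] /\
    [/\ a + b = 1, c + d = 1 & combination a b p q = combination c d r w].
Proof.
move=> cp cq cr cw sgn.
pose Lr := chord_side p q r; pose Lw := chord_side p q w.
rewrite -/Lr -/Lw in sgn.
have wr0 : Lw - Lr != 0 by apply/eqP => e; move: sgn; nra.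
pose c := Lw / (Lw - Lr); pose d := - Lr / (Lw - Lr).
have sq0 : 0 < (Lw - Lr) ^+ 2 by rewrite exprn_even_gt0.
have c0 : 0 < c.
  rewrite /c (_ : _ / _ = Lw * (Lw - Lr) / (Lw - Lr) ^+ 2).
    by rewrite divr_gt0 //; nra.
  by field.
have d0 : 0 < d.
  rewrite /d (_ : _ / _ = - Lr * (Lw - Lr) / (Lw - Lr) ^+ 2).
    by rewrite divr_gt0 //; nra.
  by field.
have cd : c + d = 1 by rewrite /c /d; field.
have Lo : c * Lr + d * Lw = 0 by rewrite /c /d; field.
pose o := combination c d r w.
have pq : p <> q.
  move=> e; move: sgn; rewrite /Lr /Lw e /chord_side.
  by rewrite !subrr !mul0r subrr mul0r ltxx.
have rw : r <> w.
  by move=> e; move: sgn; rewrite /Lr /Lw e -expr2 ltNge sqr_ge0.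
have Lo' : chord_side p q o = 0.
  by rewrite -Lo /Lr /Lw /chord_side /o /= (_ : d = 1 - c); [ring|lra].
have [a [b [ab o_eq]]] := chord_side_eq0_combination pq Lo'.
exists a, b, c, d; split => //.
have no : o.1 ^+ 2 + o.2 ^+ 2 < 1.
  have rw1 := dot_lt1 cr (unit_circle_disk cw) (nesym rw).
  have : 0 < c * d * (1 - dot r w).
    by apply: mulr_gt0; [exact: mulr_gt0 | rewrite subr_gt0].
  by have := norm_combination cd cr cw; rewrite -/o; lra.
have pq1 := dot_lt1 cp (unit_circle_disk cq) (nesym pq).
have ab0 : 0 < a * b.
  have : 0 < a * b * (1 - dot p q).
    by have := norm_combination ab cp cq; rewrite o_eq; lra.
  by rewrite pmulr_lgt0 // subr_gt0.
by split => //; nra.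
Qed.

(** In homogeneous coordinates, [k (1, u)] and [l (1, v)] have the same pairing with [(1, -p)],
    [(1, -q)] and [(1, -r)]. These are independent when [p], [q], [r] are not collinear, so the two
    vectors agree. *)
Lemma proportional_tangents p q r (u v : R * R) (k l : R) :
  chord_side p q r != 0 -> k != 0 ->
  (1 - dot p u) * k = (1 - dot p v) * l ->
  (1 - dot q u) * k = (1 - dot q v) * l ->
  (1 - dot r u) * k = (1 - dot r v) * l -> u = v.
Proof.
case: p q r u v => [p1 p2] [q1 q2] [r1 r2] [u1 u2] [v1 v2].
rewrite /chord_side /dot /= => D0 k0 hp hq hr.
pose E1 := (q1 - p1) * (k * u1 - l * v1) + (q2 - p2) * (k * u2 - l * v2).
pose E2 := (r1 - p1) * (k * u1 - l * v1) + (r2 - p2) * (k * u2 - l * v2).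
have e1 : E1 = 0.
  by rewrite /E1 -(subrr ((1 - (p1 * u1 + p2 * u2)) * k)) [in RHS]hp; lra.
have e2 : E2 = 0.
  by rewrite /E2 -(subrr ((1 - (p1 * u1 + p2 * u2)) * k)) [in RHS]hp; lra.
have f1 : k * u1 = l * v1.
  apply/subr0_eq/(mulfI D0); rewrite mulr0.
  (* Cramer's rule for the system [E1 = E2 = 0], whose determinant is [chord_side p q r]. *)
  transitivity ((r2 - p2) * E1 - (q2 - p2) * E2).
    by rewrite /E1 /E2; ring.
  by rewrite e1 e2 !mulr0 subrr.
have f2 : k * u2 = l * v2.
  apply/subr0_eq/(mulfI D0); rewrite mulr0.
  transitivity ((q1 - p1) * E2 - (r1 - p1) * E1).
    by rewrite /E1 /E2; ring.
  by rewrite e1 e2 !mulr0 subrr.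
have kl : k = l.
  have : p1 * (k * u1) + p2 * (k * u2) = p1 * (l * v1) + p2 * (l * v2).
    by rewrite f1 f2.
  by lra.
by subst l; rewrite (mulfI k0 f1) (mulfI k0 f2).
Qed.

(* The projective map [x |-> (a tau_p / kappa, c tau_r / kappa)], where
   [tau_z x = 1 - <z, x>] and [kappa x = 1 - <o, x>] for the intersection [o] of
   the two chords, sends the disk into the unit square and [p], [q], [r], [w] to
   its left, right, bottom and top sides; [h1] and [h2] are the coordinates of
   the difference of the images of the two curves, with denominators cleared. *)
Lemma disk_crossing p q r w (x y : R -> R * R) :
  unit_circle p -> unit_circle q -> unit_circle r -> unit_circle w ->
  chord_side p q r * chord_side p q w < 0 ->
  continuous x -> continuous y ->
  (forall t, unit_disk (x t)) -> (forall t, unit_disk (y t)) ->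
  x 0 = p -> x 1 = q -> y 0 = r -> y 1 = w ->
  exists s t, x s = y t.
Proof.
move=> cp cq cr cw pqrw cx cy dx dy x0 x1 y0 y1.
apply: contrapT => nomeet.
have {}nomeet s t : x s <> y t by move=> e; apply: nomeet; exists s, t.
have [a [b [c [d [[a0 b0 c0 d0] [ab cd o_eq]]]]]] :=
  chord_meet cp cq cr cw pqrw.
pose tau z u := 1 - dot z u.
pose kappa u := 1 - dot (combination a b p q) u.
have kab u : kappa u = a * tau p u + b * tau q u by exact: dot_combination.
have kcd u : kappa u = c * tau r u + d * tau w u.
  by rewrite /kappa o_eq; exact: dot_combination.
have tau_gt0 z u : unit_circle z -> unit_disk u -> u <> z -> 0 < tau z u.
  by move=> cz du uz; rewrite subr_gt0; exact: dot_lt1.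
have tau_self z : unit_circle z -> tau z z = 0.
  by rewrite /unit_circle /tau /dot /= -!expr2 => ->; rewrite subrr.
have tau_ge0 z u : unit_circle z -> unit_disk u -> 0 <= tau z u.
  move=> cz du; have [->|/eqP uz] := eqVneq u z; first by rewrite tau_self.
  exact/ltW/tau_gt0.
have pq : p <> q.
  by move=> e; move: pqrw; rewrite e /chord_side !subrr !mul0r subrr mul0r ltxx.
(* The denominator of the projective map is positive on the closed disk: [tau p] and [tau q] are
   nonnegative and never vanish together. *)
have k_gt0 u : unit_disk u -> 0 < kappa u.
  move=> du; rewrite kab.
  have [->|/eqP up] := eqVneq u p.
    rewrite tau_self // mulr0 add0r mulr_gt0 // tau_gt0 //.
    exact: unit_circle_disk.
  by rewrite ltr_pwDl ?mulr_gt0 ?mulr_ge0 ?tau_gt0 ?tau_ge0 // ltW.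
pose h z (u v : R * R) := tau z u * kappa v - tau z v * kappa u.
have ctau z (v : R * R -> R * R) : continuous v ->
    continuous (fun st => tau z (v st)).
  move=> cv st; apply: cvgB; first exact: cvg_cst.
  by apply: cvgD; apply: cvgMl_tmp;
    [exact: continuous_fst | exact: continuous_snd].
have ch z (u v : R * R -> R * R) : continuous u -> continuous v ->
    continuous (fun st => h z (u st) (v st)).
  move=> cu cv st; apply: cvgB; apply: cvgM; exact: ctau.
have cx1 : continuous (fun st : R * R => x st.1).
  move=> st; apply: (@cvg_comp _ _ _ fst x _ _ _ _ (cx _)).
  exact: (@continuous_fst _ id (fun=> @cvg_id _ _)).
have cy2 : continuous (fun st : R * R => y st.2).
  move=> st; apply: (@cvg_comp _ _ _ snd y _ _ _ _ (cy _)).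
  exact: (@continuous_snd _ id (fun=> @cvg_id _ _)).
have [||s [t [_ _ h1 h2]]] := poincare_miranda
    (ch p _ _ cx1 cy2) (ch r _ _ cy2 cx1).
- move=> t _; rewrite /h /= x0 x1; split.
    rewrite tau_self // mul0r sub0r oppr_lt0 mulr_gt0 ?k_gt0 ?tau_gt0 //.
      by rewrite -x0; apply/nesym/nomeet.
    exact: unit_circle_disk.
  (* As [tau q q = 0], the terms with weight [a] cancel. *)
  rewrite (_ : _ - _ = tau p q * (b * tau q (y t))); last first.
    by rewrite !kab tau_self //; ring.
  rewrite !mulr_gt0 ?tau_gt0 //; last by rewrite -x1; apply/nesym/nomeet.
    exact: unit_circle_disk.
  exact/nesym.
- move=> s _; rewrite /h /= y0 y1; split.
    rewrite tau_self // mul0r sub0r oppr_lt0 mulr_gt0 ?k_gt0 ?tau_gt0 //.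
      by rewrite -y0; apply/nomeet.
    exact: unit_circle_disk.
  rewrite (_ : _ - _ = tau r w * (d * tau w (x s))); last first.
    by rewrite !kcd tau_self //; ring.
  rewrite !mulr_gt0 ?tau_gt0 //; last by rewrite -y1; apply/nomeet.
    exact: unit_circle_disk.
  move=> e; have := nomeet 1; move: pqrw; rewrite e -expr2.
  by rewrite ltNge sqr_ge0.
- apply: (nomeet s t).
  have k0 := k_gt0 _ (dx s); have l0 := k_gt0 _ (dy t).
  have b_neq0 := lt0r_neq0 b0.
  (* Because [kappa] is [a * tau p + b * tau q], the proportion for [p] entails the one for [q], the
     third needed to identify the points. *)
  have hq : tau q (x s) * kappa (y t) = tau q (y t) * kappa (x s).
    apply: (mulfI b_neq0); move: h1; rewrite /h /= (kab (x s)) (kab (y t)).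
    by move/eqP; rewrite subr_eq0 => /eqP; nra.
  apply: (@proportional_tangents p q r _ _ (kappa (y t)) (kappa (x s))) => //.
  - by apply/eqP => e; move: pqrw; rewrite e mul0r ltxx.
  - exact: lt0r_neq0.
  - exact/subr0_eq.
  - exact/esym/subr0_eq.
Qed.

Lemma chord_sideC p q x : chord_side q p x = - chord_side p q x.
Proof. by rewrite /chord_side; ring. Qed.

Lemma chord_side_eq0 p q x :
  unit_circle p -> unit_circle q -> unit_circle x -> p <> q ->
  chord_side p q x = 0 -> x = p \/ x = q.
Proof.
move=> cp cq cx pq /(chord_side_eq0_combination pq)[a [b [ab xE]]].
have := norm_combination ab cp cq; rewrite xE (cx : _ = 1) subrr => /esym/eqP.
have pq1 := dot_lt1 cp (unit_circle_disk cq) (nesym pq).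
rewrite !mulf_eq0 pnatr_eq0 /= subr_eq0 [1 == _]gt_eqF // orbF.
case/orP => /eqP e; [right|left]; rewrite -xE /combination.
  have -> : b = 1 by lra.
  by rewrite e !mul0r !mul1r !add0r -surjective_pairing.
have -> : a = 1 by lra.
by rewrite e !mul0r !mul1r !addr0 -surjective_pairing.
Qed.

(** The witnesses are the two unit normals of the chord. The distance [|d| / N] from the centre to
    the chord is less than 1, so they lie on different sides. *)
Lemma circle_both_sides p q : unit_circle p -> unit_circle q -> p <> q ->
  exists u v, [/\ unit_circle u, unit_circle v,
    chord_side p q u < 0 & 0 < chord_side p q v].
Proof.
move=> cp cq pq.
have pq1 := dot_lt1 cp (unit_circle_disk cq) (nesym pq).
pose a := q.1 - p.1; pose b := q.2 - p.2; pose N := Num.sqrt (a ^+ 2 + b ^+ 2).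
have NN : N ^+ 2 = a ^+ 2 + b ^+ 2 by rewrite sqr_sqrtr // addr_ge0 ?sqr_ge0.
have N2E : N ^+ 2 = 2 * (1 - dot p q).
  move: cp cq; rewrite NN /unit_circle /dot /a /b /=; nra.
have N0 : 0 < N.
  by rewrite lt0r sqrtr_ge0 andbT -sqrf_eq0 N2E; apply: lt0r_neq0; lra.
have N_neq0 := lt0r_neq0 N0.
pose d := q.1 * p.2 - q.2 * p.1.
have d2 : d ^+ 2 = (1 - dot p q) * (1 + dot p q).
  transitivity ((p.1 ^+ 2 + p.2 ^+ 2) * (q.1 ^+ 2 + q.2 ^+ 2) - dot p q ^+ 2).
    by rewrite /d /dot; ring.
  by rewrite (cp : _ = 1) (cq : _ = 1); ring.
have dN : d ^+ 2 < N ^+ 2 by rewrite d2 N2E; nra.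
have side k : chord_side p q (- (k * b / N), k * a / N) = k * N - d.
  rewrite /chord_side /= -/a -/b.
  transitivity (k * (a ^+ 2 + b ^+ 2) / N - d).
    by rewrite /d /a /b; field.
  by rewrite -NN; field.
have circ k : k ^+ 2 = 1 -> unit_circle (- (k * b / N), k * a / N).
  move=> k2; rewrite /unit_circle /=.
  transitivity (k ^+ 2 * (a ^+ 2 + b ^+ 2) / N ^+ 2); first by field.
  by rewrite k2 -NN; field.
exists (- (-1 * b / N), -1 * a / N), (- (1 * b / N), 1 * a / N).
by split; rewrite ?side; try (apply: circ; ring); nra.
Qed.

End Disk.

(** * Edge paths as curves in the realization *)

Section Walks.
Context {R : realType} {V : finType}.
Implicit Types (x y v : V) (s : seq V) (t u : R) (z : {ptws V -> R}).

(** A tent supported on [[-1, 1]]. A path is a sum of shifted tents, one per visited vertex, so its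
    continuity needs no case split at integer times. *)
Definition hat t : R := Num.max 0 (1 - `|t|).

(* The point reached at time [t] when the path [x :: s] is traversed with one
   edge per unit of time; meaningless outside [0 <= t <= size s]. *)
Fixpoint walk x s t (v : V) : R :=
  (x == v)%:R * hat t + (if s is y :: s' then walk y s' (t - 1) v else 0).

Definition segment_pt x y t : {ptws V -> R} :=
  fun v => (x == v)%:R * (1 - t) + (y == v)%:R * t.

Lemma hat_out t : 1 <= `|t| -> hat t = 0.
Proof. by move=> t1; rewrite /hat; apply/max_l; rewrite subr_le0. Qed.

Lemma hat_in t : `|t| <= 1 -> hat t = 1 - `|t|.
Proof. by move=> t1; rewrite /hat; apply/max_r; rewrite subr_ge0. Qed.

Lemma hat_lt1 t : t != 0 -> hat t < 1.
Proof.
by move=> t0; rewrite gt_max ltr01 gtrBl normr_gt0.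
Qed.

Lemma continuous_hat : continuous hat.
Proof.
move=> t; apply: (@continuous_max _ _ (fun=> 0) (fun t => 1 - `|t|)).
  exact: cvg_cst.
by apply: cvgB; [exact: cvg_cst | exact: norm_continuous].
Qed.

Lemma walk_out x s t v : t <= -1 -> walk x s t v = 0.
Proof.
elim: s x t => [|y s IH] x t t1 /=; rewrite hat_out ?mulr0 ?addr0 //.
- by rewrite ler0_norm; lra.
- by rewrite IH ?add0r //; lra.
- by rewrite ler0_norm; lra.
Qed.

Lemma walk_start x s t v : -1 <= t -> t <= 0 ->
  walk x s t v = (x == v)%:R * (1 + t).
Proof.
move=> t1 t0; have e : hat t = 1 + t by rewrite hat_in ler0_norm //; lra.
case: s => [|y s] /=; rewrite e ?addr0 //.
by rewrite walk_out ?addr0 //; lra.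
Qed.

Lemma walk0 x s : walk x s 0 = vertex_pt x.
Proof.
by apply/funext => v; rewrite walk_start // ?lerN10 // addr0 mulr1 eq_sym.
Qed.

Lemma walk_first x y s t : 0 <= t <= 1 -> walk x (y :: s) t = segment_pt x y t.
Proof.
move=> /andP[t0 t1]; apply/funext => v /=; rewrite walk_start; [|lra|lra].
by rewrite hat_in ger0_norm // /segment_pt; congr (_ + _ * _); lra.
Qed.

Lemma walk_next x y s t : 1 <= t -> walk x (y :: s) t = walk y s (t - 1).
Proof.
move=> t1; apply/funext => v /=; rewrite hat_out ?mulr0 ?add0r //.
by rewrite ger0_norm //; lra.
Qed.

Lemma walk_last x s : walk x s (size s)%:R = vertex_pt (last x s).
Proof.
elim: s x => [|y s IH] x; first exact: walk0.
by rewrite walk_next /= ?ler1n // -natr1 addrK IH.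
Qed.

Lemma sum_vertex_pt x : \sum_v vertex_pt x v = 1 :> R.
Proof.
rewrite (bigD1 x) //= /vertex_pt eqxx big1 ?addr0 // => w /negPf ->.
by [].
Qed.

Lemma sum_segment_pt x y t : \sum_v segment_pt x y t v = 1.
Proof.
rewrite big_split /= -!mulr_suml.
rewrite [X in X * _](_ : _ = 1); last first.
  rewrite -[RHS](sum_vertex_pt x); apply: eq_bigr => v _.
  by rewrite /vertex_pt eq_sym.
rewrite [X in _ + X * _](_ : _ = 1); last first.
  rewrite -[RHS](sum_vertex_pt y); apply: eq_bigr => v _.
  by rewrite /vertex_pt eq_sym.
ring.
Qed.

Lemma walk_sub x s t v : walk x s t v != 0 -> v \in x :: s.
Proof.
elim: s x t => [|y s IH] x t /=.
  by rewrite addr0 inE (eq_sym v); case: (x == v); rewrite ?mul0r ?eqxx.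
rewrite inE (eq_sym v); case: (x == v) => //=.
by rewrite mul0r add0r => /IH.
Qed.

Lemma continuous_walk x s : continuous (walk x s : R -> {ptws V -> R}).
Proof.
have cv v : continuous (fun t => walk x s t v).
  elim: s x => [|y s IH] x t /=.
    apply: cvgD; last exact: cvg_cst.
    by apply: cvgMl_tmp; exact: continuous_hat.
  apply: cvgD; first by apply: cvgMl_tmp; exact: continuous_hat.
  apply: (@cvg_comp _ _ _ (fun t => t - 1) (fun t => walk y s t v)).
    by apply: cvgB; [exact: cvg_id | exact: cvg_cst].
  exact: IH.
move=> t; apply/cvg_sup => v; move: t.
apply/(@continuousP _ (initial_topology (fun z : {ptws V -> R} => z v))).
move=> _ [B oB <-].
have -> : (walk x s : R -> {ptws V -> R}) @^-1`
    ((fun z : {ptws V -> R} => z v) @^-1` B) =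
    (fun t => walk x s t v) @^-1` B by [].
by apply: open_comp => // t _; exact: cv.
Qed.

Lemma segment_pt_realization (e : rel V) (K : {set {set V}}) x y t :
  e x y -> 0 <= t <= 1 -> realization (simplices e K) (segment_pt x y t).
Proof.
move=> exy /andP[t0 t1]; split.
- by move=> v; rewrite addr_ge0 // mulr_ge0 ?ler0n // subr_ge0.
- exact: sum_segment_pt.
rewrite !inE; apply/orP; left.
have [->|t_neq0] := eqVneq t 0.
  apply/orP; left; apply/existsP; exists x; apply/eqP/setP => v.
  by rewrite !inE /segment_pt subr0 mulr1 mulr0 addr0 (eq_sym v) pnatr_eq0;
    case: (x == v).
have [->|t_neq1] := eqVneq t 1.
  apply/orP; left; apply/existsP; exists y; apply/eqP/setP => v.
  by rewrite !inE /segment_pt subrr mulr1 mulr0 add0r (eq_sym v) pnatr_eq0;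
    case: (y == v).
apply/orP; right; apply/existsP; exists x; apply/existsP; exists y.
rewrite exy /=; apply/eqP/setP => v; rewrite !inE /segment_pt !(eq_sym v).
have t1' : 1 - t != 0 by rewrite subr_eq0 eq_sym.
case: (x == v); case: (y == v) => /=; rewrite !(mul1r, mul0r, addr0, add0r).
- by rewrite subrK oner_eq0.
- by [].
- by [].
- by rewrite eqxx.
Qed.

Lemma vertex_pt_realization (e : rel V) (K : {set {set V}}) x :
  realization (simplices e K) (vertex_pt x : {ptws V -> R}).
Proof.
split; [by move=> v; exact: ler0n | exact: sum_vertex_pt | ].
rewrite !inE; apply/orP; left; apply/orP; left; apply/existsP; exists x.
by apply/eqP/setP => v; rewrite !inE /vertex_pt pnatr_eq0; case: (v == x).
Qed.

Lemma vertex_pt_inj : injective (vertex_pt : V -> {ptws V -> R}).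
Proof.
move=> x y /(congr1 (fun z => z y)); rewrite /vertex_pt eqxx eq_sym.
by have [//|_] := eqVneq x y; move=> /eqP; rewrite eq_sym oner_eq0.
Qed.

Lemma walk_realization (e : rel V) (K : {set {set V}}) x s t :
  path e x s -> 0 <= t <= (size s)%:R ->
  realization (simplices e K) (walk x s t).
Proof.
elim: s x t => [|y s IH] x t.
  move=> _ /le_anti t0; rewrite -t0 walk0; exact: vertex_pt_realization.
case/andP=> exy pys /andP[t0 tn]; have [t1|t1] := leP t 1.
  by rewrite walk_first ?t0 //; apply: segment_pt_realization => //; rewrite t0.
rewrite walk_next; last exact: ltW.
by apply: IH => //; move: tn; rewrite /= -natr1; lra.
Qed.

Lemma segment_walk (e : rel V) x s a b z : irreflexive e ->
  path e x s -> (a, b) \in pairmap pair x s -> segment a b z ->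
  exists2 t, 0 <= t <= (size s)%:R & walk x s t = z.
Proof.
move=> irr; elim: s x => // y s IH x /andP[exy pys].
rewrite [pairmap _ _ _]/= inE => /orP[/eqP[-> ->]|abs] abz; last first.
  have [t /andP[t0 tn] tz] := IH _ pys abs abz.
  exists (t + 1); first by rewrite /= -natr1 lerD2r tn andbT; lra.
  by rewrite walk_next ?addrK //; lra.
case: abz => z0 z1 /fintype.subsetP zxy.
have xy : x != y by apply: contraTneq exy => ->; rewrite irr.
have zout v : v != x -> v != y -> z v = 0.
  move=> vx vy; apply/eqP; apply: contraNT vx => zv.
  by have := zxy v; rewrite !inE zv (negPf vy) orbF => ->.
have zx : z x = 1 - z y.
  move: z1; rewrite (bigD1 x) //= (bigD1 y) 1?eq_sym //= big1 ?addr0.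
    by move=> <-; rewrite addrK.
  by move=> v /andP[]; exact: zout.
have zy1 : 0 <= z y <= 1 by have := z0 y; have := z0 x; lra.
(* The time spent on the edge is the barycentric weight of its far end. *)
exists (z y).
  by rewrite /= -natr1; have := ler0n R (size s); lra.
rewrite walk_first //; apply/funext => v; rewrite /segment_pt.
case: (altP (x =P v)) => [<-|xv].
  by rewrite eq_sym (negPf xy) mul1r mul0r addr0 zx.
rewrite mul0r add0r; case: (altP (y =P v)) => [<-|yv]; first by rewrite mul1r.
by rewrite mul0r zout // eq_sym.
Qed.

Lemma walk_vertex x s v : v \in x :: s ->
  exists2 t, 0 <= t <= (size s)%:R & walk x s t = vertex_pt v.
Proof.
elim: s x => [|y s IH] x; rewrite inE.
  by move=> /eqP ->; exists 0; rewrite ?lexx ?walk0.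
case/orP=> [/eqP ->|/IH[t /andP[t0 tn] <-]].
  by exists 0; rewrite ?lexx ?ler0n ?walk0.
exists (t + 1); first by rewrite /= -natr1 lerD2r tn andbT; lra.
by rewrite walk_next ?addrK //; lra.
Qed.

(** The start is visited once, so its coordinate is the single tent [hat t], below 1 as soon as
    [t > 0]. *)
Lemma walk_leaves_start x s t : x \notin s -> 0 < t ->
  walk x s t <> vertex_pt x.
Proof.
move=> xs t0 /(congr1 (fun z => z x)); rewrite /vertex_pt eqxx /=.
have ht := hat_lt1 (lt0r_neq0 t0).
suff -> : walk x s t x = hat t by move=> e; move: ht; rewrite e ltxx.
case: s xs => [|y s] xs /=; rewrite eqxx mul1r ?addr0 //.
have [->|/walk_sub] := eqVneq (walk y s (t - 1) x) 0; first by rewrite addr0.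
by rewrite (negPf xs).
Qed.

Lemma walk_reaches_end x s t : uniq (x :: s) -> t < (size s)%:R ->
  walk x s t <> vertex_pt (last x s).
Proof.
move=> us tn /(congr1 (fun z => z (last x s))); rewrite /vertex_pt eqxx /=.
suff -> : walk x s t (last x s) = hat (t - (size s)%:R).
  have ht : t - (size s)%:R != 0 by rewrite subr_eq0 lt_eqF.
  by move=> e; move: (hat_lt1 ht); rewrite e ltxx.
elim: s x t us {tn} => [|y s IH] x t /=.
  by rewrite eqxx mul1r addr0 subr0.
case/andP=> xs us; rewrite IH //.
have -> : x == last y s = false.
  by apply: contraNF xs => /eqP ->; exact: mem_last.
by rewrite mul0r add0r -natr1; congr hat; ring.
Qed.

(** Clamping makes a curve on [[0, 1]] continuous on the whole line and always inside the
    realization, as [disk_crossing] expects. *)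
Definition clamp t : R := Num.min 1 (Num.max 0 t).

Lemma clamp_in t : 0 <= clamp t <= 1.
Proof.
by rewrite le_min ler01 le_max lexx /= ge_min lexx.
Qed.

Lemma clamp_id t : 0 <= t <= 1 -> clamp t = t.
Proof. by move=> /andP[t0 t1]; rewrite /clamp max_r // min_r. Qed.

Lemma continuous_clamp : continuous clamp.
Proof.
move=> t; apply: (@continuous_min _ _ (fun=> 1) (fun t => Num.max 0 t)).
  exact: cvg_cst.
apply: (@continuous_max _ _ (fun=> 0) id); first exact: cvg_cst.
exact: cvg_id.
Qed.

Definition curve x s t : {ptws V -> R} := walk x s (clamp t * (size s)%:R).

Lemma continuous_curve x s : continuous (curve x s).
Proof.
move=> t; apply: (@cvg_comp _ _ _ (fun t => clamp t * (size s)%:R)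
  (walk x s : R -> {ptws V -> R})); last exact: continuous_walk.
by apply: cvgMr_tmp; exact: continuous_clamp.
Qed.

Lemma curve_realization (e : rel V) (K : {set {set V}}) x s t :
  path e x s -> realization (simplices e K) (curve x s t).
Proof.
move=> pxs; apply: walk_realization => //; have /andP[t0 t1] := clamp_in t.
by rewrite mulr_ge0 //= ler_piMl.
Qed.

Lemma curve0 x s : curve x s 0 = vertex_pt x.
Proof. by rewrite /curve clamp_id ?lexx ?ler01 // mul0r walk0. Qed.

Lemma curve1 x s : curve x s 1 = vertex_pt (last x s).
Proof. by rewrite /curve clamp_id ?lexx ?ler01 // mul1r walk_last. Qed.

Lemma walk_curve x s t : 0 <= t <= (size s)%:R ->
  exists2 t', 0 <= t' <= 1 & curve x s t' = walk x s t.
Proof.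
move=> /andP[t0 tn]; have [s0|n0] := posnP (size s).
  have {tn}t0' : t = 0 by apply/le_anti; rewrite t0 andbT (le_trans tn) // s0.
  by exists 0; rewrite ?lexx ?ler01 // curve0 t0' walk0.
have n0' : 0 < (size s)%:R :> R by rewrite ltr0n.
have t01 : 0 <= t / (size s)%:R <= 1.
  by apply/andP; split; [exact: divr_ge0 t0 (ltW n0') |
    rewrite ler_pdivrMr // mul1r].
by exists (t / (size s)%:R) => //; rewrite /curve clamp_id // divfK // gt_eqF.
Qed.

Lemma curve_interior x s t : uniq (x :: s) -> s != [::] -> 0 < t < 1 ->
  curve x s t <> vertex_pt x /\ curve x s t <> vertex_pt (last x s).
Proof.
move=> us s0 /andP[t0 t1].
have n0 : 0 < (size s)%:R :> R by rewrite ltr0n lt0n size_eq0.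
rewrite /curve clamp_id ?(ltW t0) ?(ltW t1) //; split.
  by apply: walk_leaves_start; [case/andP: us | exact: mulr_gt0].
by apply: walk_reaches_end => //; rewrite gtr_pMl.
Qed.

Lemma walk_segment x s t : s != [::] -> 0 <= t <= (size s)%:R ->
  exists2 ab, ab \in pairmap pair x s & segment ab.1 ab.2 (walk x s t).
Proof.
elim: s x t => // y s IH x t _ /andP[t0 tn]; have [t1|t1] := leP t 1.
  have t01 : 0 <= t <= 1 by rewrite t0.
  exists (x, y); first by rewrite /= mem_head.
  rewrite walk_first //; split.
  - by move=> v; rewrite addr_ge0 // mulr_ge0 ?ler0n // subr_ge0.
  - exact: sum_segment_pt.
  - apply/fintype.subsetP => v; rewrite !inE !(eq_sym v) /segment_pt /=.
    by case: (x == v) => //; case: (y == v) => //; rewrite !mul0r addr0 eqxx.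
have s0 : s != [::].
  by apply: contraTneq tn => ->; rewrite -ltNge.
rewrite walk_next ?(ltW t1) //.
have [|ab abs abt] := IH y (t - 1) s0.
  by move: tn; rewrite /= -natr1; lra.
by exists ab => //=; rewrite inE abs orbT.
Qed.

Lemma curve_segment x s t : s != [::] ->
  exists2 ab, ab \in pairmap pair x s & segment ab.1 ab.2 (curve x s t).
Proof.
move=> s0; apply: walk_segment => //; have /andP[t0 t1] := clamp_in t.
by rewrite mulr_ge0 //= ler_piMl.
Qed.

End Walks.

(** * The boundary circle *)

Lemma continuous_comp_into (X Y Z : topologicalType) (A : set Y)
    (h : X -> Y) (k : Y -> Z) :
  continuous h -> (forall x, A (h x)) -> {within A, continuous k} ->
  continuous (k \o h).
Proof.
move=> ch Ah wk x U nU.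
have ck := (@subspace_continuousP _ A _ k).1 wk.
have kU := ck _ (Ah x) U nU.
apply: (@filterS _ (nbhs x) _ _ _ _ (ch x _ kU)) => y /= H; exact: H.
Qed.

Lemma continuous_comp_within (X Y Z : topologicalType) (A : set X) (B : set Y)
    (h : X -> Y) (k : Y -> Z) :
  {within A, continuous h} -> (forall x, A x -> B (h x)) ->
  {within B, continuous k} -> {within A, continuous (k \o h)}.
Proof.
move=> wh AB wk; have ch := (@subspace_continuousP _ A _ h).1 wh.
have ck := (@subspace_continuousP _ B _ k).1 wk.
apply/(@subspace_continuousP _ A _ (k \o h)) => x Ax U nU.
have /(ch x Ax) kU : nbhs (h x) [set y | B y -> U (k y)].
  exact: ck (AB _ Ax) U nU.
apply: (@filterS _ (nbhs x) _ _ _ _ kU) => y /= H Ay.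
exact: H Ay (AB _ Ay).
Qed.

Lemma nonvanishing_same_sign (R : realType) (h : R -> R) :
  continuous h -> (forall t, 0 < t < 1 -> h t != 0) ->
  forall s t, 0 < s < 1 -> 0 < t < 1 -> 0 < h s * h t.
Proof.
move=> ch h0 s t.
wlog st : s t / s <= t.
  move=> H s01 t01; have [st|ts] := leP s t; first exact: H.
  by rewrite mulrC; apply: H => //; exact: ltW.
move=> s01 t01; rewrite lt0r mulf_neq0 ?h0 //= leNgt; apply/negP => hst.
have [|c] := @IVT _ h s t 0 st (continuous_subspaceT ch).
  by rewrite ge_min le_max; have := h0 _ s01; have := h0 _ t01; nra.
rewrite in_itv /= => /andP[sc ct] hc; have := h0 c.
by rewrite hc eqxx => /(_ _)/negP; apply; lra.
Qed.

Section CyclicEdges.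
Context {V : eqType}.
Implicit Types (x y : V) (s L : seq V).

Definition cycle_edges L : seq (V * V) :=
  if L is x :: s then pairmap pair x (rcons s x) else [::].

Lemma cycle_edgesC L L' : cycle_edges (L ++ L') =i cycle_edges (L' ++ L).
Proof.
case: L => [|x s]; first by rewrite cats0.
case: L' => [|y s'] ab; first by rewrite cats0.
rewrite /= !rcons_cat !pairmap_cat /= -!cats1 !pairmap_cat /= !mem_cat !inE.
rewrite !mem_cat !inE.
case: (ab \in pairmap _ x s); case: (ab \in pairmap _ y s'); 
 case: (ab == (last x s, y)); case: (ab == (last y s', x)) => //.
Qed.

Lemma cycle_edges_split x y s s' : cycle_edges (x :: s ++ y :: s') =
  pairmap pair x (rcons s y) ++ pairmap pair y (rcons s' x).
Proof. by rewrite /= rcons_cat -cat_rcons pairmap_cat last_rcons. Qed.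

Lemma path_pairmap (e : rel V) x s :
  path e x s = all (fun ab => e ab.1 ab.2) (pairmap pair x s).
Proof. by elim: s x => //= y s IH x; rewrite IH. Qed.

Lemma zip_pairmap x s y : zip (x :: s) (rcons s y) = pairmap pair x (rcons s y).
Proof. by elim: s x => //= z s IH x; rewrite IH. Qed.

Lemma index_uniq_cat L x L' :
  uniq (L ++ x :: L') -> index x (L ++ x :: L') = size L.
Proof.
rewrite cat_uniq => /and3P[_ /= /norP[xL _] _].
by rewrite index_cat (negPf xL) /= eqxx addn0.
Qed.

(** Cyclic order is decided by arithmetic on [index]; this converts the outcome back into a
    decomposition of the list. *)
Lemma split_between L (p q : V) : uniq L -> p \in L -> q \in L ->
  (index p L < index q L)%N ->
  exists l0 l1 l3, L = l0 ++ p :: l1 ++ q :: l3 /\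
    [/\ forall x, x \in L -> (index x L < index p L)%N -> x \in l0,
        forall x, x \in L -> (index p L < index x L < index q L)%N -> x \in l1
      & forall x, x \in L -> (index q L < index x L)%N -> x \in l3].
Proof.
have idxL (x : V) l l' : x \in l -> (index x (l ++ l') < size l)%N.
  by move=> xl; rewrite index_cat xl index_mem.
have idxR (x : V) l l' : x \notin l -> (size l <= index x (l ++ l'))%N.
  by move=> xl; rewrite index_cat (negPf xl) leq_addr.
move=> uL pL; move: uL; case/path.splitPr: pL => l0 m uL qL.
rewrite index_uniq_cat // => pq.
have qm : q \in m.
  move: qL; rewrite mem_cat inE => /or3P[ql0|/eqP qp|//].
    by move: pq; rewrite ltnNge ltnW // idxL.
  by move: pq; rewrite qp index_uniq_cat // ltnn.
move: uL qL pq; case/path.splitPr: qm => l1 l3 uL qL pq.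
exists l0, l1, l3; split=> //.
have uL' : uniq ((l0 ++ p :: l1) ++ q :: l3) by rewrite -catA.
have LE : l0 ++ p :: l1 ++ q :: l3 = (l0 ++ p :: l1) ++ q :: l3.
  by rewrite -catA.
have iq : index q (l0 ++ p :: l1 ++ q :: l3) = size (l0 ++ p :: l1).
  by rewrite LE index_uniq_cat.
rewrite iq; split=> x xL.
- by apply: contraTT => xl0; rewrite -leqNgt idxR.
- case/andP=> px xq; have : x \in l0 ++ p :: l1.
    by apply: contraTT xq => xl; rewrite -leqNgt LE idxR.
  rewrite mem_cat inE => /or3P[xl0|/eqP xp|//].
    by move: px; rewrite ltnNge ltnW // idxL.
  by move: px; rewrite xp index_uniq_cat // ltnn.
- move=> qx; move: xL; rewrite LE mem_cat inE => /or3P[xl|/eqP xq|//].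
    by move: qx; rewrite LE ltnNge ltnW // idxL.
  by move: qx; rewrite xq iq ltnn.
Qed.

End CyclicEdges.

Section OppositeSides.
Context {R : realType} {V : finType}.
Variables (e : rel V) (K : {set {set V}}) (phi : {ptws V -> R} -> R * R).
Hypothesis e_irr : irreflexive e.
Hypothesis phi_cont : {within realization (simplices e K), continuous phi}.
Hypothesis phi_inj : forall y z, realization (simplices e K) y ->
  realization (simplices e K) z -> phi y = phi z -> y = z.

Local Notation P v := (phi (vertex_pt v)).

Lemma phi_vertex_inj x y : P x = P y -> x = y.
Proof.
move/phi_inj => H; apply: (@vertex_pt_inj R V).
by apply: H; exact: vertex_pt_realization.
Qed.

Lemma continuous_phi_curve x s : path e x s ->
  continuous (fun t => phi (curve x s t)).
Proof.
move=> pxs; apply: (@continuous_comp_into _ _ _ _ (curve x s) phi) phi_cont.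
  exact: continuous_curve.
by move=> t; apply: curve_realization.
Qed.

Definition on_circle (l : seq (V * V)) : Prop := forall ab, ab \in l ->
  e ab.1 ab.2 /\ (phi @` segment ab.1 ab.2 `<=` @unit_circle R).

(** A line meets the circle at most twice, here at the two ends, and the curve is at its ends only
    at times 0 and 1. Hence [chord_side] has no zero in between. *)
Lemma arc_one_side x s : uniq (x :: s) -> s != [::] ->
  on_circle (pairmap pair x s) ->
  forall t t', 0 < t < 1 -> 0 < t' < 1 ->
  0 < chord_side (P x) (P (last x s)) (phi (curve x s t)) *
      chord_side (P x) (P (last x s)) (phi (curve x s t')).
Proof.
move=> us s0 circ.
have pxs : path e x s by rewrite path_pairmap; apply/allP => ab /circ[].
have cc t : unit_circle (phi (curve x s t)).
  have [ab /circ[_ H] abt] := curve_segment x t s0.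
  by apply: H; exists (curve x s t).
have xl : x <> last x s.
  case: s us s0 {circ pxs cc} => // y s /andP[xs _] _ /= xl.
  by move: xs; rewrite xl mem_last.
apply: nonvanishing_same_sign => [|t t01].
  have cp := continuous_phi_curve pxs.
  move=> t; rewrite /chord_side; apply: cvgB; apply: cvgMl_tmp;
    (apply: cvgB; last exact: cvg_cst).
    exact: continuous_snd.
  exact: continuous_fst.
have [n0 n1] := curve_interior us s0 t01.
apply/eqP => /chord_side_eq0 []; rewrite ?cc //.
- by rewrite -(curve0 x s); exact: cc.
- by rewrite -(curve1 x s); exact: cc.
- by move/phi_vertex_inj.
- by move/phi_inj => H; apply: n0; apply: H;
    [exact: curve_realization | exact: vertex_pt_realization].
- by move/phi_inj => H; apply: n1; apply: H;
    [exact: curve_realization | exact: vertex_pt_realization].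
Qed.

Lemma arc_vertex x s v : v \in s -> v != last x s -> uniq (x :: s) ->
  exists2 t : R, 0 < t < 1 & curve x s t = (vertex_pt v : {ptws V -> R}).
Proof.
move=> vs vl /andP[xs _].
have vx : v != x by apply: contraNneq xs => <-.
have [|t tn tv] := @walk_vertex R V x s v; first by rewrite inE vs orbT.
have [t' /andP[t0 t1] tt'] := walk_curve x tn.
rewrite tv in tt'; exists t' => //; rewrite !lt_neqAle t0 t1 !andbT.
apply/andP; split; apply/eqP => te.
  move: tt'; rewrite -te curve0 => /vertex_pt_inj/eqP.
  by rewrite eq_sym (negPf vx).
move: tt'; rewrite te curve1 => /vertex_pt_inj/eqP.
by rewrite eq_sym (negPf vl).
Qed.

Lemma arc_side_neq0 x s v : uniq (x :: s) -> v \in s -> v != last x s ->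
  on_circle (pairmap pair x s) -> chord_side (P x) (P (last x s)) (P v) != 0.
Proof.
move=> us vs vl circ; have s0 : s != [::] by case: s vs {us vl circ}.
have [t t01 tv] := arc_vertex vs vl us.
have := arc_one_side us s0 circ t01 t01; rewrite tv -/(P v) -expr2.
by move=> /lt0r_neq0; rewrite expf_eq0.
Qed.

(** The inequality is weak because [u] may be an end of the arc, where [chord_side] vanishes. *)
Lemma arc_sign x s v u : uniq (x :: s) -> v \in s -> v != last x s ->
  on_circle (pairmap pair x s) ->
  (exists2 ab, ab \in pairmap pair x s & (phi @` segment ab.1 ab.2) u) ->
  0 <= chord_side (P x) (P (last x s)) (P v) *
       chord_side (P x) (P (last x s)) u.
Proof.
move=> us vs vl circ [[a b] /= abs [z abz <-]].
have s0 : s != [::] by case: s vs {us vl circ abs}.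
have pxs : path e x s by rewrite path_pairmap; apply/allP => ab /circ[].
have [t0 t0n <-] := segment_walk e_irr pxs abs abz.
have [t t01 <-] := walk_curve x t0n.
have [t' t'01 tv] := arc_vertex vs vl us.
have side := arc_one_side us s0 circ.
have [->|tn0] := eqVneq t 0.
  by rewrite curve0 -/(P x) /chord_side !subrr !mulr0 subrr mulr0.
have [->|tn1] := eqVneq t 1.
  rewrite curve1 -/(P (last x s)) {2}/chord_side [X in X - _]mulrC subrr mulr0.
  by [].
have := side _ t t'01; rewrite tv -/(P v); move=> H; apply/ltW/H.
by case/andP: t01 => ? ?; rewrite !lt_neqAle eq_sym tn0 tn1; apply/andP.
Qed.

Lemma on_circle_vertex x s v : on_circle (pairmap pair x s) -> v \in s ->
  unit_circle (P v).
Proof.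
move=> xs_circ vs; have s0 : s != [::] by case: s vs {xs_circ}.
have [|t tn tv] := @walk_vertex R V x s v; first by rewrite inE vs orbT.
have [t' _ tt'] := walk_curve x tn.
have [ab /xs_circ[_ H] abt] := curve_segment x t' s0.
by apply: H; exists (curve x s t'); rewrite // -tv -tt'.
Qed.

(* The two open arcs of the circle do not meet the line through [P p] and [P q],
   so each lies on one side of it; were it the same side, the circle would lie
   on one side of its chord. *)
Lemma opposite_sides p q r w s1 s2 (L := p :: s1 ++ q :: s2) :
  uniq L -> on_circle (cycle_edges L) ->
  (forall u, unit_circle u -> exists2 ab, ab \in cycle_edges L &
     (phi @` segment ab.1 ab.2) u) ->
  r \in s1 -> w \in s2 ->
  chord_side (P p) (P q) (P r) * chord_side (P p) (P q) (P w) < 0.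
Proof.
rewrite /L cycle_edges_split => uL circ cover rs1 ws2.
have uL1 : uniq (p :: rcons s1 q).
  by move: uL; rewrite -cat_rcons -cat_cons cat_uniq => /and3P[].
have uL2 : uniq (q :: rcons s2 p).
  by move: uL; rewrite -cat_cons uniq_catC -cat_rcons cat_uniq => /and3P[].
have circ1 : on_circle (pairmap pair p (rcons s1 q)).
  by move=> ab abs; apply: circ; rewrite mem_cat abs.
have circ2 : on_circle (pairmap pair q (rcons s2 p)).
  by move=> ab abs; apply: circ; rewrite mem_cat abs orbT.
have rq : r != last p (rcons s1 q).
  rewrite last_rcons; apply: contraTneq rs1 => ->.
  by move: uL1; rewrite /= rcons_uniq => /and3P[].
have wp : w != last q (rcons s2 p).
  rewrite last_rcons; apply: contraTneq ws2 => ->.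
  by move: uL2; rewrite /= rcons_uniq => /and3P[].
have rs1' : r \in rcons s1 q by rewrite mem_rcons inE rs1 orbT.
have ws2' : w \in rcons s2 p by rewrite mem_rcons inE ws2 orbT.
have s1u u := @arc_sign p (rcons s1 q) r u uL1 rs1' rq circ1.
have s2u u := @arc_sign q (rcons s2 p) w u uL2 ws2' wp circ2.
rewrite !last_rcons in s1u s2u.
have cp : unit_circle (P p).
  by apply: on_circle_vertex circ2 _; rewrite mem_rcons mem_head.
have cq : unit_circle (P q).
  by apply: on_circle_vertex circ1 _; rewrite mem_rcons mem_head.
have pq : P p <> P q.
  move/phi_vertex_inj => pq; move: uL1; rewrite -pq /= mem_rcons mem_head.
  by [].
have [u [v [cu cv su sv]]] := circle_both_sides cp cq pq.
have sr0 : chord_side (P p) (P q) (P r) != 0.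
  by have := arc_side_neq0 uL1 rs1' rq circ1; rewrite last_rcons.
have sw0 : chord_side (P p) (P q) (P w) != 0.
  have := arc_side_neq0 uL2 ws2' wp circ2.
  by rewrite last_rcons chord_sideC oppr_eq0.
rewrite ltNge; apply/negP => rw0.
have {}rw0 : 0 < chord_side (P p) (P q) (P r) * chord_side (P p) (P q) (P w).
  by rewrite lt0r rw0 mulf_neq0.
have same u' : unit_circle u' ->
    0 <= chord_side (P p) (P q) (P r) * chord_side (P p) (P q) u'.
  move=> cu'; have [ab + H] := cover _ cu'.
  rewrite mem_cat => /orP[] abs; first by apply: s1u; exists ab.
  have : 0 <= chord_side (P p) (P q) (P w) * chord_side (P p) (P q) u'.
    (* The second arc runs from [q] to [p]; reversing the chord changes both signs. *)
    by rewrite -mulrNN -!chord_sideC; apply: s2u; exists ab.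
  by move: sw0; rewrite neq_lt => /orP[]; nra.
have := same _ cu; have := same _ cv.
by move: sr0; rewrite neq_lt => /orP[]; nra.
Qed.

End OppositeSides.

(** * Crossing edge paths *)

Section Crossing.
Context {R : realType} {V : finType} {Q : quadrilateral R}.
Variable T : triangulation V Q.

Let K := realization (simplices (edge T) (tri T)) : set {ptws V -> R}.

(** [phi] is [emb] followed by the inverse of the chart. The last clause identifies the boundary of
    [Q] with the unit circle. *)
Lemma disk_coordinates : exists phi : {ptws V -> R} -> R * R,
  [/\ {within K, continuous phi},
      forall y z, K y -> K z -> phi y = phi z -> y = z,
      forall z, K z -> unit_disk (phi z) &
      forall z u, K z -> unit_circle u -> emb T z = chart Q u <-> phi z = u].
Proof.
have [[disk_fun _ disk_surj] _ [k [k_cont kK]]] := chartP Q.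
have [[emb_fun emb_inj _] emb_cont _] := embP T.
have chartK q : disk Q q -> exists2 u, unit_disk u & chart Q u = q.
  by move=> /disk_surj[u du uq]; exists u.
exists (k \o emb T); split.
- exact: (@continuous_comp_within _ _ _ K (disk Q) (emb T) k).
- move=> y z Ky Kz /=.
  have [u du uE] := chartK _ (emb_fun _ Ky).
  have [v dv vE] := chartK _ (emb_fun _ Kz).
  rewrite -uE -vE !kK // => uv; apply: emb_inj; rewrite ?inE //.
  by rewrite -uE -vE uv.
- by move=> z Kz; have [u du uE] := chartK _ (emb_fun _ Kz); rewrite /= -uE kK.
- move=> z u Kz /unit_circle_disk du; split=> /=.
    by move=> ->; rewrite kK.
  by have [v dv vE] := chartK _ (emb_fun _ Kz); rewrite -vE kK // => ->.
Qed.

Lemma enum_I4 : enum 'I_4 = [:: 0; 1; 2; 3].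
Proof. by apply: (inj_map val_inj); rewrite val_enum_ord. Qed.

Definition boundary_cycle : seq V :=
  flatten [seq corner T i :: inner T i | i <- enum 'I_4].

Definition side_edges (i : 'I_4) : seq (V * V) :=
  pairmap pair (corner T i) (rcons (inner T i) (corner T (ordS i))).

Lemma cycle_edges_boundary ab :
  (ab \in cycle_edges boundary_cycle) = [exists i, ab \in side_edges i].
Proof.
have -> : cycle_edges boundary_cycle =
    flatten [seq side_edges i | i <- enum 'I_4].
  rewrite /boundary_cycle enum_I4 /side_edges /=.
  have -> : ordS 0 = 1 :> 'I_4 by exact: val_inj.
  have -> : ordS 1 = 2 :> 'I_4 by exact: val_inj.
  have -> : ordS 2 = 3 :> 'I_4 by exact: val_inj.
  have -> : ordS 3 = 0 :> 'I_4 by exact: val_inj.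
  rewrite !cats0 !(rcons_cat, rcons_cons) -!cat_rcons.
  by rewrite !pairmap_cat !last_rcons.
apply/flatten_mapP/existsP => [[i _ H]|[i H]]; exists i => //.
by rewrite mem_enum.
Qed.

(** A corner may be assigned to either of its two arcs, so positions are known only up to weak
    inequalities; disjointness of the parts makes them strict. The piece [l3 ++ l0] wraps around
    because [w] may be corner 0, at the head of the list. *)
Lemma parts_on_boundary p r q w :
  p \in part T 0 -> r \in part T 1 -> q \in part T 2 -> w \in part T 3 ->
  exists l0 l1 l3, boundary_cycle = l0 ++ p :: l1 ++ q :: l3 /\
    (r \in l1) && (w \in l3 ++ l0).
Proof.
move=> p0 r1 q2 w3.
have := part_side p0; have := part_side r1.
have := part_side q2; have := part_side w3.
have -> : ordS 0 = 1 :> 'I_4 by exact: val_inj.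
have -> : ordS 1 = 2 :> 'I_4 by exact: val_inj.
have -> : ordS 2 = 3 :> 'I_4 by exact: val_inj.
have -> : ordS 3 = 0 :> 'I_4 by exact: val_inj.
have uL : uniq boundary_cycle := sides_uniq T.
have LE : boundary_cycle = (corner T 0 :: inner T 0) ++
    (corner T 1 :: inner T 1) ++ (corner T 2 :: inner T 2) ++
    (corner T 3 :: inner T 3).
  by rewrite /boundary_cycle enum_I4 /= cats0.
have neq i j u v : i != j -> u \in part T i -> v \in part T j -> u != v.
  move=> ij ui vj; apply: contraNneq ij => uv; rewrite uv in ui.
  exact/eqP/(part_disjoint ui vj).
have pr : p != r by exact: neq p0 r1.
have rq : r != q by exact: neq r1 q2.
have qw : q != w by exact: neq q2 w3.
have pw : p != w by exact: neq p0 w3.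
pose idx v := index v boundary_cycle.
have idx_eq u v : u \in boundary_cycle -> v \in boundary_cycle -> u != v ->
    idx u <> idx v.
  by move=> uL' vL' /eqP uv iuv; apply: uv; rewrite -(nth_index u uL')
    -[RHS](nth_index u vL') -/(idx u) iuv.
have in_block l A l' v : boundary_cycle = l ++ A ++ l' -> v \in A ->
    v \in boundary_cycle /\ (size l <= idx v < size l + size A)%N.
  move=> E vA; rewrite /idx E !mem_cat vA orbT; split=> //.
  move: uL; rewrite E cat_uniq => /and3P[_ /hasPn H _].
  have /negPf vl : v \notin l by apply: H; rewrite mem_cat vA.
  by rewrite !index_cat vl vA leq_addr ltn_add2l index_mem.
have first_block l x l' : boundary_cycle = l ++ x :: l' -> idx x = size l.
  by move=> E; move: uL; rewrite /idx E; exact: index_uniq_cat.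
pose A0 := corner T 0 :: inner T 0; pose A1 := corner T 1 :: inner T 1.
pose A2 := corner T 2 :: inner T 2; pose A3 := corner T 3 :: inner T 3.
have E1 : boundary_cycle = A0 ++ A1 ++ (A2 ++ A3) by [].
have E2 : boundary_cycle = (A0 ++ A1) ++ A2 ++ A3 by rewrite -catA.
have E3 : boundary_cycle = (A0 ++ A1 ++ A2) ++ A3 ++ [::].
  by rewrite cats0 -!catA.
have B0 v := in_block [::] A0 _ v LE; have B1 v := in_block _ _ _ v E1.
have B2 v := in_block _ _ _ v E2; have B3 v := in_block _ _ _ v E3.
have C0 := first_block [::] (corner T 0) _ LE.
have C1 := first_block _ (corner T 1) _ E1.
have C2 := first_block _ (corner T 2) _ E2.
have C3 := first_block _ (corner T 3) _ E3.
have in1 : corner T 1 \in boundary_cycle by case: (B1 _ (mem_head _ _)).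
have in2 : corner T 2 \in boundary_cycle by case: (B2 _ (mem_head _ _)).
have in3 : corner T 3 \in boundary_cycle by case: (B3 _ (mem_head _ _)).
have in0 : corner T 0 \in boundary_cycle by case: (B0 _ (mem_head _ _)).
have side i j v : v \in corner T i :: rcons (inner T i) (corner T j) ->
    v \in corner T i :: inner T i \/ v = corner T j.
  rewrite inE mem_rcons inE => /or3P[/eqP ->|/eqP ->|vi].
  - by left; rewrite mem_head.
  - by right.
  - by left; rewrite inE vi orbT.
rewrite !size_cat in B2 B3 C2 C3.
have s1_gt0 : (0 < size A1)%N by [].
have s2_gt0 : (0 < size A2)%N by [].
have s3_gt0 : (0 < size A3)%N by [].
move=> /side wS /side qS /side rS /side pS.
have [pL pi] : p \in boundary_cycle /\ (idx p <= size A0)%N.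
  case: pS => [/B0[-> /andP[_ /ltnW]] //|->].
  by rewrite C1.
have [rL ri] : r \in boundary_cycle /\
    (size A0 <= idx r <= size A0 + size A1)%N.
  case: rS => [/B1[-> /andP[-> /ltnW ->]] //|->].
  by rewrite C2 leq_addr leqnn.
have [qL qi] : q \in boundary_cycle /\
    (size A0 + size A1 <= idx q <= size A0 + (size A1 + size A2))%N.
  case: qS => [/B2[-> /andP[-> /ltnW]] //|->]; first by rewrite addnA.
  by rewrite C3 leq_add2l leq_addr leqnn.
have [wL wi] : w \in boundary_cycle /\
    (size A0 + (size A1 + size A2) <= idx w \/ idx w = 0)%N.
  case: wS => [/B3[-> /andP[-> _]]|->]; split=> //; first by left.
  by right; rewrite C0.
have := idx_eq _ _ pL rL pr; have := idx_eq _ _ rL qL rq.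
have := idx_eq _ _ qL wL qw; have := idx_eq _ _ pL wL pw.
move=> ipw iqw irq ipr.
have [pr_lt rq_lt wq] : [/\ (idx p < idx r)%N, (idx r < idx q)%N &
    (idx q < idx w)%N \/ (idx w < idx p)%N].
  move: (idx p) (idx r) (idx q) (idx w) (size A0) (size A1) (size A2)
    pi ri qi wi s1_gt0 s2_gt0 ipw iqw irq ipr; clear=> ip ir iq iw a0 a1 a2.
  move=> pi /andP[ri ri'] /andP[qi qi'] wi s1 s2 pw qw rq pr.
  by split; lia.
have [|l0 [l1 [l3 [E [H0 H1 H3]]]]] := split_between uL pL qL.
  exact: ltn_trans pr_lt rq_lt.
exists l0, l1, l3; split=> //; apply/andP; split.
  by apply: H1 => //; apply/andP.
rewrite mem_cat; apply/orP.
by case: wq => wq; [left; exact: H3 | right; exact: H0].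
Qed.

Lemma edge_path_crossing x s y s' :
  path (edge T) x s -> path (edge T) y s' ->
  x \in P3 T -> last x s \in P1 T -> y \in P4 T -> last y s' \in P2 T ->
  exists2 v, v \in x :: s & v \in y :: s'.
Proof.
move=> pxs pys q3 p1 w4 r2.
have [phi [phi_cont phi_inj phi_disk phi_circ]] := disk_coordinates.
have [l0 [l1 [l3 [LE /andP[rl1 wl]]]]] := parts_on_boundary p1 r2 q3 w4.
set p := last x s in p1 LE; set r := last y s' in r2 rl1.
set L := boundary_cycle in LE.
(* The cycle is rotated to start at [p], so that both arcs between [p] and [x] are contiguous. *)
pose L' := p :: l1 ++ x :: (l3 ++ l0).
have uL' : uniq L'.
  have : uniq L := sides_uniq T.
  by rewrite LE uniq_catC /= -catA.
have eL' : cycle_edges L' =i cycle_edges L.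
  by move=> ab; rewrite LE cycle_edgesC /L' /= -catA.
have seg_K ab z : ab \in cycle_edges L' -> segment ab.1 ab.2 z -> K z.
  case: ab => a b; rewrite eL' cycle_edges_boundary => /existsP[i abi] abz.
  have pi := side_path T i.
  have [t tn <-] := segment_walk (@edge_irr _ _ _ T) pi abi abz.
  exact: walk_realization.
have circ : on_circle (edge T) phi (cycle_edges L').
  move=> ab abL; have := abL.
  rewrite eL' cycle_edges_boundary => /existsP[i abi]; split.
    by have := side_path T i; rewrite path_pairmap => /allP; apply.
  move=> _ [z abz <-].
  have : boundary_pts Q (emb T z).
    rewrite (sides_boundary T); exists i; exists ab; last by exists z.
    by rewrite zip_pairmap.
  by case=> u cu /esym/(phi_circ z u (seg_K ab z abL abz) cu) ->.
have cover u : unit_circle u -> exists2 ab, ab \in cycle_edges L' &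
     (phi @` segment ab.1 ab.2) u.
  move=> cu; have : boundary_pts Q (chart Q u) by exists u.
  rewrite (sides_boundary T) => -[i [ab abi [z abz zu]]].
  have abL : ab \in cycle_edges L'.
    by rewrite eL' cycle_edges_boundary; apply/existsP; exists i;
      rewrite /side_edges -zip_pairmap.
  exists ab => //; exists z => //.
  exact/(phi_circ z u (seg_K ab z abL abz) cu).
have opp :=
  opposite_sides (@edge_irr _ _ _ T) phi_cont phi_inj uL' circ cover rl1 wl.
have onc v : v \in L' -> unit_circle (phi (vertex_pt v)).
  move=> vL; apply: (@on_circle_vertex _ _ (edge T) phi p
    (rcons (l1 ++ x :: l3 ++ l0) p)) => //.
  by move: vL; rewrite mem_rcons.
have Lp : p \in L' by rewrite mem_head.
have Lx : x \in L' by rewrite /L' inE mem_cat mem_head !orbT.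
have Lr : r \in L' by rewrite /L' inE mem_cat rl1 !orbT.
have Ly : y \in L' by rewrite /L' inE mem_cat inE wl !orbT.
pose side v := chord_side (phi (vertex_pt x)) (phi (vertex_pt p))
  (phi (vertex_pt v)).
have opp' : side y * side r < 0.
  by rewrite /side !(chord_sideC (phi (vertex_pt p))) mulrNN mulrC.
have cK u l t : path (edge T) u l -> K (curve u l t).
  exact: curve_realization.
have [s0 [t0 st]] := @disk_crossing R _ _ _ _
  (fun t => phi (curve x s t)) (fun t => phi (curve y s' t))
  (onc x Lx) (onc p Lp) (onc y Ly) (onc r Lr) opp'
  (continuous_phi_curve phi_cont pxs) (continuous_phi_curve phi_cont pys)
  (fun t => phi_disk _ (cK x s t pxs)) (fun t => phi_disk _ (cK y s' t pys))
  (congr1 phi (curve0 x s)) (congr1 phi (curve1 x s))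
  (congr1 phi (curve0 y s')) (congr1 phi (curve1 y s')).
have {}st := phi_inj _ _ (cK x s s0 pxs) (cK y s' t0 pys) st.
(* Barycentric coordinates sum to 1, so one of them is nonzero at the common point. *)
have [v vx] : exists v, curve x s s0 v != 0.
  apply: contrapT => nov; have [_ c1 _] := cK x s s0 pxs.
  have : \sum_v curve x s s0 v = 0.
    apply: big1 => v _; apply/eqP/negPn/negP => cv; by apply: nov; exists v.
  by rewrite c1 => /eqP; rewrite oner_eq0.
exists v; first exact: walk_sub vx.
by rewrite st in vx; exact: walk_sub vx.
Qed.

End Crossing.

(** * Energy and flux *)

(** The gap is [a] times the weighted variance of [d] about its mean [b / a]; if [a = 0], all
    weights vanish. *)
Lemma weighted_cauchy_schwarz (R : realType) (I : finType) (P : pred I)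
    (c d : I -> R) : (forall i, P i -> 0 <= c i) ->
  \sum_(i | P i) c i * d i <=
  Num.sqrt (\sum_(i | P i) c i) * Num.sqrt (\sum_(i | P i) c i * d i ^+ 2).
Proof.
move=> c0; set a := \sum_(i | P i) c i; set b := \sum_(i | P i) c i * d i.
set e := \sum_(i | P i) _.
have a0 : 0 <= a by exact: sumr_ge0.
have e0 : 0 <= e by apply: sumr_ge0 => i /c0 ci; rewrite mulr_ge0 ?sqr_ge0.
suff bae : b ^+ 2 <= a * e.
  rewrite -sqrtrM //; apply: (le_trans (ler_norm b)).
  by rewrite -sqrtr_sqr ler_wsqrtr.
have [a_eq0|a_neq0] := eqVneq a 0.
  have -> : b = 0.
    by apply: big1 => i Pi; rewrite (psumr_eq0P c0 a_eq0) ?mul0r.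
  by rewrite expr0n /= mulr_ge0.
have : 0 <= a * \sum_(i | P i) c i * (d i - b / a) ^+ 2.
  by rewrite mulr_ge0 // sumr_ge0 // => i /c0 ci; rewrite mulr_ge0 ?sqr_ge0.
suff -> : \sum_(i | P i) c i * (d i - b / a) ^+ 2 = e - b ^+ 2 / a.
  by rewrite mulrBr mulrCA divff // mulr1 subr_ge0.
transitivity (e - 2 * (b / a) * b + (b / a) ^+ 2 * a); last by field.
rewrite /e {3}/b /a 2!mulr_sumr -sumrB -big_split /=.
by apply: eq_bigr => i _; ring.
Qed.

(** The flux bound charges each vertex of a path once, whereas the length charges every visit. *)
Lemma sum_mem_le (R : realType) (I : finType) (s : seq I) (h : I -> R) :
  (forall i, 0 <= h i) -> \sum_(i in s) h i <= \sum_(i <- s) h i.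
Proof.
move=> h0; elim: s => [|x s IH]; first by rewrite big_nil big_pred0.
rewrite big_cons; have [xs|xs] := boolP (x \in s).
  apply: (@le_trans _ _ (\sum_(i in s) h i)); last by rewrite ler_wpDl.
  rewrite le_eqVlt; apply/orP; left; apply/eqP/eq_bigl => i.
  by rewrite inE; case: eqP => // ->.
rewrite (bigD1 x) ?mem_head //= lerD2l; apply: le_trans IH.
rewrite le_eqVlt; apply/orP; left; apply/eqP/eq_bigl => i.
by rewrite inE; case: eqP => [->|]; rewrite ?(negPf xs) ?andbF ?andbT.
Qed.

Section Network.
Context {R : realType} {V : finType} {Q : quadrilateral R}.
Variables (T : triangulation V Q) (c : V -> V -> R).
Hypothesis c_pos : conductance T c.

Lemma adj_sym : symmetric (adj T).
Proof. by move=> x y; rewrite /adj (edge_sym T) orbC. Qed.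

Lemma adj_conductance_gt0 x y : adj T x y -> 0 < c x y.
Proof. by case/andP => /c_pos[]. Qed.

Lemma adj_conductanceC x y : adj T x y -> c x y = c y x.
Proof. by case/andP => /c_pos[]. Qed.

Lemma gradient_metricE f x : gradient_metric T c f x =
  Num.sqrt (\sum_(y | adj T x y) c x y * (f y - f x) ^+ 2).
Proof.
rewrite /gradient_metric /edge_norm /edge_dot /df_vector /dn_vector.
by case: ifP => _; congr Num.sqrt; apply: eq_bigr => y /adj_conductance_gt0 cxy;
  field; rewrite gt_eqF.
Qed.

Lemma conductance_normE x : edge_norm T c x (conductance_vector c x) =
  Num.sqrt (\sum_(y | adj T x y) c x y).
Proof.
rewrite /edge_norm /edge_dot /conductance_vector; congr Num.sqrt.
by apply: eq_bigr => y /adj_conductance_gt0 cxy; field; rewrite gt_eqF.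
Qed.

Lemma gradient_metric_ge0 f x : 0 <= gradient_metric T c f x.
Proof. by rewrite gradient_metricE sqrtr_ge0. Qed.

(** Summation by parts: swapping the ends of every edge replaces the factor [f x] by [- f y], and
    the mean of both forms is the energy. *)
Lemma energy_laplacian f :
  energy T c f = \sum_x f x * laplacian T c f x.
Proof.
set S := RHS.
have S1 : S = \sum_x \sum_(y | adj T x y) c x y * (f x - f y) * f x.
  apply: eq_bigr => x _; rewrite /laplacian mulr_sumr.
  by apply: eq_bigr => y _; ring.
have S2 : S = - \sum_x \sum_(y | adj T x y) c x y * (f x - f y) * f y.
  rewrite S1 (exchange_big_dep xpredT) //= -sumrN; apply: eq_bigr => x _.
  rewrite -sumrN; under eq_bigl do rewrite adj_sym.
  by apply: eq_bigr => y xy; rewrite -(adj_conductanceC xy); ring.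
rewrite /energy; apply: (@mulIf _ 2) => //; rewrite divfK //.
rewrite mulr_natr mulr2n {1}S1 S2 -sumrB; apply: eq_bigr => x _.
by rewrite -sumrB; apply: eq_bigr => y _; ring.
Qed.

(** Edges inside [A] contribute antisymmetric pairs that cancel. The remaining flux is indexed by
    its outer end, so that it can be charged to the vertices of the path. *)
Lemma sum_laplacian f (A : {set V}) :
  \sum_(x in A) laplacian T c f x =
  \sum_(y in ~: A) \sum_(x | adj T y x && (x \in A)) c y x * (f x - f y).
Proof.
have -> : \sum_(x in A) laplacian T c f x =
    \sum_(x in A) \sum_(y | adj T x y && (y \in A)) c x y * (f x - f y) +
    \sum_(x in A) \sum_(y | adj T x y && (y \notin A)) c x y * (f x - f y).
  by rewrite -big_split; apply: eq_bigr => x _; exact: bigID.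
set S := (X in X + _).
have S0 : S = - S.
  rewrite {1}/S (exchange_big_dep (mem A)) /=; last by move=> x y _ /andP[].
  rewrite -sumrN; apply: eq_bigr => y yA; rewrite -sumrN.
  apply: eq_big => [x|x /andP[xA /andP[xy _]]].
    by rewrite adj_sym yA andbT andbC.
  by rewrite (adj_conductanceC xy); ring.
have -> : S = 0 by lra.
rewrite add0r (exchange_big_dep (mem (~: A)%SET)) /=; last first.
  by move=> x y _ /andP[]; rewrite inE.
apply: eq_bigr => y; rewrite inE => yA.
apply: eq_big => [x|x /andP[xA /andP[xy _]]].
  by rewrite adj_sym yA andbT andbC.
by rewrite (adj_conductanceC xy).
Qed.

Lemma flux_le f y (A : {set V}) :
  \sum_(x | adj T y x && (x \in A)) c y x * (f x - f y) <=
  edge_norm T c y (conductance_vector c y) * gradient_metric T c f y.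
Proof.
rewrite conductance_normE gradient_metricE.
(* With absolute values all terms are nonnegative, so the sum over [A] can be enlarged to all
   neighbours of [y]. *)
under [X in _ <= _ * Num.sqrt X]eq_bigr do rewrite -real_normK ?num_real //.
apply: le_trans (weighted_cauchy_schwarz _ _); last first.
  by move=> x /adj_conductance_gt0/ltW.
rewrite [leRHS](bigID (mem A)) /=.
rewrite -[leLHS]addr0 lerD //.
  apply: ler_sum => x /andP[/adj_conductance_gt0/ltW cyx _].
  by rewrite ler_wpM2l // ler_norm.
by apply: sumr_ge0 => x /andP[/adj_conductance_gt0/ltW cyx _]; rewrite mulr_ge0.
Qed.

Lemma edge_drop_le f m x y : lbound (sqrt_conductances T c) m -> 0 <= m ->
  adj T x y -> m * (f y - f x) <= gradient_metric T c f x.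
Proof.
move=> lm m0 xy; have cxy := adj_conductance_gt0 xy.
apply: (@le_trans _ _ (Num.sqrt (c x y * (f y - f x) ^+ 2))).
  rewrite (sqrtrM _ (ltW cxy)) sqrtr_sqr.
  apply: (@le_trans _ _ (m * `|f y - f x|)).
    by rewrite ler_wpM2l ?ler_norm.
  by rewrite ler_wpM2r //; apply: lm; exists x, y.
rewrite gradient_metricE ler_wsqrtr // (bigD1 y) //= lerDl.
by apply: sumr_ge0 => z /andP[/adj_conductance_gt0/ltW cz _];
  rewrite mulr_ge0 ?sqr_ge0.
Qed.

Lemma path_drop_le f m x s : lbound (sqrt_conductances T c) m -> 0 <= m ->
  path (adj T) x s ->
  m * (f (last x s) - f x) <= path_length (gradient_metric T c f) (x :: s).
Proof.
rewrite /path_length => lm m0; elim: s x => [|y s IH] x /=.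
  by rewrite subrr mulr0 big_seq1 gradient_metric_ge0.
case/andP => xy pys; rewrite big_cons.
have -> : f (last y s) - f x = (f y - f x) + (f (last y s) - f y) by ring.
by rewrite mulrDr lerD ?IH //; exact: edge_drop_le.
Qed.

Hypothesis deltaFE : deltaF T = (P1 T :|: P2 T :|: P3 T :|: P4 T)%SET.

Lemma part_notin_F i x : x \in part T i -> x \notin F T.
Proof.
move=> xi; suff : x \in deltaF T by rewrite inE => /andP[].
rewrite deltaFE !inE; have := mem_enum 'I_4 i; rewrite enum_I4 !inE.
by case/or4P => /eqP ii; rewrite ii in xi; rewrite /P1 /P2 /P3 /P4 xi ?orbT.
Qed.

Lemma part_neq i j x : i != j -> x \in part T i -> x \notin part T j.
Proof.
by move=> ij xi; apply: contraNN ij => xj; apply/eqP/(part_disjoint xi xj).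
Qed.

(** Outside [F] all neighbours lie in [F], so on [P1] and [P3] the Laplacian is the normal
    derivative. A vertex outside [Fbar] has no neighbours and its sum is empty. *)
Lemma laplacian_eq0 g f x : DN_boundary_value_function T c g f ->
  x \notin P2 T -> x \notin P4 T -> laplacian T c f x = 0.
Proof.
move=> [_ [harm [_ [_ neum]]]] x2 x4.
have [xF|xF] := boolP (x \in F T); first exact: harm.
have adjF y : adj T x y = adj T x y && (y \in F T).
  by rewrite /adj (negPf xF) /= -andbA andbb.
have [x13|x13] := boolP (x \in P1 T :|: P3 T)%SET.
  rewrite -(neum x x13) /laplacian /normal_derivative.
  by under eq_bigl do rewrite adjF.
apply: big_pred0 => y; apply/negbTE/negP; rewrite adjF => /andP[/andP[xy _] yF].
have : x \in deltaF T by rewrite inE xF; apply/existsP; exists y; rewrite yF.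
by rewrite deltaFE; move: x13 x2 x4; rewrite !inE; do 4 case: (x \in _).
Qed.

Lemma energy_flux g f : DN_boundary_value_function T c g f ->
  energy T c f = g * \sum_(x in P4 T) laplacian T c f x.
Proof.
move=> Hf; have [_ [_ [f2 [f4 _]]]] := Hf.
rewrite energy_laplacian mulr_sumr (bigID (mem (P4 T))) /= [X in _ + X]big1.
  by rewrite addr0; apply: eq_bigr => x /f4 ->.
move=> x x4; have [x2|x2] := boolP (x \in P2 T); first by rewrite f2 ?mul0r.
by rewrite (laplacian_eq0 Hf) ?mulr0.
Qed.

(* [A] is the set of vertices joined to [P4] off the path; it misses [P2] by
   planarity, so the whole flux leaving [P4] crosses the path. *)
Lemma energy_le g f M x s :
  DN_boundary_value_function T c g f -> 0 < g -> 0 <= M ->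
  (forall y, y \in x :: s -> edge_norm T c y (conductance_vector c y) <= M) ->
  path (edge T) x s -> x \in P3 T -> last x s \in P1 T ->
  (forall y, y \in x :: s -> (y \notin P2 T) && (y \notin P4 T)) ->
  energy T c f <= g * (M * path_length (gradient_metric T c f) (x :: s)).
Proof.
move=> Hf g0 M0 normM pxs x3 l1 off.
set b := x :: s in normM off *.
rewrite (energy_flux Hf) ler_pM2l //.
pose e := [rel y z | [&& adj T y z, y \notin b & z \notin b]].
pose A : {set V} :=
  [set y | (y \notin b) && [exists z in P4 T, connect e z y]]%SET.
have P4A y : y \in P4 T -> y \in A.
  move=> y4; have yb : y \notin b by apply/negP => /off; rewrite y4 andbF.
  by rewrite inE yb; apply/existsP; exists y; rewrite y4 connect0.
have AP2 y : y \in A -> y \notin P2 T.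
  rewrite inE => /andP[yb /existsP[z /andP[z4 /connectP[l pl yE]]]].
  apply/negP => y2; have zb : z \notin b.
    by apply/negP => /off; rewrite z4 andbF.
  have lb : all (fun v => v \notin b) l.
    by elim: l z pl {z4 zb yE} => //= v l IH z /andP[/and3P[_ _ ->] /IH].
  have pel : path (edge T) z l.
    by apply: sub_path pl => u v /= /and3P[/andP[]].
  rewrite yE in y2; have [v vb] := edge_path_crossing pxs pel x3 l1 z4 y2.
  rewrite inE => /orP[/eqP vz|vl]; first by move: zb; rewrite -vz vb.
  by move/allP: lb => /(_ v vl); rewrite vb.
have Aadj y z : y \in A -> adj T y z -> z \notin b -> z \in A.
  rewrite !inE => /andP[yb /existsP[t /andP[t4 ty]]] yz zb; rewrite zb.
  apply/existsP; exists t; rewrite t4; apply: connect_trans ty _.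
  by apply: connect1; rewrite /= yz yb.
have -> : \sum_(y in P4 T) laplacian T c f y = \sum_(y in A) laplacian T c f y.
  rewrite [RHS](bigID (mem (P4 T))) /= [X in _ = _ + X]big1 ?addr0.
    apply: eq_bigl => y.
    by case: (boolP (y \in P4 T)) => [/P4A ->|]; rewrite ?andbF.
  by move=> y /andP[/AP2 y2 y4]; exact: laplacian_eq0 Hf y2 y4.
rewrite sum_laplacian.
apply: (@le_trans _ _ (\sum_(y in b) M * gradient_metric T c f y)); last first.
  rewrite -mulr_sumr ler_wpM2l // /path_length; apply: sum_mem_le => y.
  exact: gradient_metric_ge0.
(* A vertex off the path with a neighbour in [A] belongs to [A], so the flux leaves [A] only into
   the path. *)
rewrite (bigID (mem b)) /= [X in _ + X]big1 ?addr0; last first.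
  move=> y /andP[yA yb]; apply: big_pred0 => z; apply/negbTE/negP.
  case/andP=> yz zA; move: yA; rewrite inE (Aadj z y) //; by rewrite adj_sym.
have Ab y : y \in b -> y \in ~: A by rewrite !inE => ->.
rewrite [leLHS](eq_bigl (mem b)); last first.
  by move=> y /=; case: (boolP (y \in b)) => [/Ab ->|]; rewrite ?andbF.
apply: ler_sum => y yb; apply: le_trans (flux_le _ _ _) _.
by rewrite ler_wpM2r ?gradient_metric_ge0 ?normM.
Qed.

End Network.

Theorem theorem3p5 (R : realType) (V : finType) (Q : quadrilateral R)
    (T : triangulation V Q)
    (HdeltaF : deltaF T = (P1 T :|: P2 T :|: P3 T :|: P4 T)%SET)
    (c : V -> V -> R) (Hc : conductance T c)
    (g : R) (Hg : 0 < g)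
    (f : V -> R) (Hf : DN_boundary_value_function T c g f)
    (M : R) (HM : is_maximum (conductance_norms T c) M)
    (m : R) (Hm : is_minimum (sqrt_conductances T c) m) :
  (forall gamma : seq V,
     shortest (gradient_metric T c f) (vertically_thick T) gamma ->
     path_length (gradient_metric T c f) gamma >= energy T c f / (g * M)) /\
  (forall gamma : seq V,
     shortest (gradient_metric T c f) (horizontally_thick T) gamma ->
     path_length (gradient_metric T c f) gamma >= g * m).
Proof.
have m0 : 0 <= m by case: Hm => -[x [y [_ ->]]] _; exact: sqrtr_ge0.
have M0 : 0 <= M by case: HM => -[[x _ ->]|[x _ ->]] _; exact: sqrtr_ge0.
have thick_ends A B S x s : thick_path T A B S (x :: s) ->
    [/\ path (adj T) x s, x \in A, last x s \in B &
    forall y, y \in x :: s -> [\/ y = x, y = last x s | y \in F T]].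
  move=> [pxs [[xA lB] [_ [inF _]]]].
  have lE : nth x (x :: s) (size s) = last x s by rewrite nth_last.
  rewrite lE in lB; split=> //.
  - by have := set11 x; rewrite -xA inE => /andP[].
  - by have := set11 (last x s); rewrite -lB inE => /andP[].
  move=> y /(nthP x)[i]; rewrite /= ltnS => is_ <-.
  have [->|i0] := posnP i; first exact: Or31.
  have [->|il] := eqVneq i (size s); first by apply: Or32; rewrite lE.
  by apply/Or33/inF; rewrite i0 -ltnS prednK ?(leq_trans i0) // ltn_neqAle il.
split=> -[|x s] [thick _] //; last first.
  have [pxs x2 l4 _] := thick_ends _ _ _ _ _ thick.
  have [_ [_ [f2 [f4 _]]]] := Hf.
  have := path_drop_le Hc f Hm.2 m0 pxs.
  by rewrite f4 // f2 // subr0 mulrC.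
have [pxs x3 l1 inF] := thick_ends _ _ _ _ _ thick.
have FN i y : y \in F T -> y \notin part T i.
  by apply: contraTN; exact: part_notin_F.
have normM y : y \in x :: s -> edge_norm T c y (conductance_vector c y) <= M.
  have inD z : z \in P1 T \/ z \in P3 T -> z \in deltaF T.
    by rewrite HdeltaF !inE => -[] ->; rewrite ?orbT.
  case/inF => [->|->|yF]; apply: HM.2; [right|right|left].
  - by exists x => //; apply: inD; right.
  - by exists (last x s) => //; apply: inD; left.
  - by exists y.
(* The ends are in [P3] and [P1], disjoint from the other parts, and the inner vertices are in
   [F]. *)
have off y : y \in x :: s -> (y \notin P2 T) && (y \notin P4 T).
  case/inF => [->|->|yF]; apply/andP; split;
    by [exact: part_neq x3 | exact: part_neq l1 | exact: FN].
have pes : path (edge T) x s by apply: sub_path pxs => u v /andP[].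
have le := energy_le Hc HdeltaF Hf Hg M0 normM pes x3 l1 off.
(* For [M = 0] the quotient is 0 by the convention on inverses, and lengths are nonnegative. *)
have [->|M_neq0] := eqVneq M 0.
  by rewrite mulr0 invr0 mulr0 sumr_ge0 // => y _; exact: gradient_metric_ge0.
by rewrite ler_pdivrMr ?mulr_gt0 // 1?lt0r ?M_neq0 // mulrC -mulrA.
Qed.
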